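(* Let $X,Y$ be Banach spaces and let $\mathcal{J}$ be a collection of disjoint intervals in $\mathbb{R}$. Suppose that $X$ has cotype $q\in[2,\infty]$ and $Y$ has type $t\in[1,2]$. Let $\frac1r:=\frac1t-\frac1q$ (so $r\in[1,\infty]$). Then every $f\in\ell^r(R^r(\mathcal{J};\mathcal{L}(X,Y)))$ has $\mathcal{R}$-bounded range, with $$\mathcal{R}(\operatorname{Ran}(f))\le C_{X,Y,q,t}\,\|f\|_{\ell^r(R^r(\mathcal{J};\mathcal{L}(X,Y)))},$$ where the constant $C_{X,Y,q,t}$ depends only on $X,Y,q,t$. Moreover, for $s\in[1,r)$, every $f\in\ell^r(V^s(\mathcal{J};\mathcal{L}(X,Y)))$ has $\mathcal{R}$-bounded range, with $$\mathcal{R}(\operatorname{Ran}(f))\le C_{X,Y,q,s,t}\,\|f\|_{\ell^r(V^s(\mathcal{J};\mathcal{L}(X,Y)))},$$ where the constant $C_{X,Y,q,s,t}$ depends only on $X,Y,q,s,t$.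
   Context: All Banach spaces are complex. $\mathcal{L}(X,Y)$ is the space of bounded linear operators from $X$ to $Y$. Type and cotype: let $(\varepsilon_n)_{n\ge1}$ be a Rademacher sequence. $Y$ has type $t$ if $(\mathbb{E}\|\sum_{n=1}^N\varepsilon_ny_n\|^2)^{1/2}\le C(\sum_{n=1}^N\|y_n\|^t)^{1/t}$ for all finite sequences in $Y$; $X$ has cotype $q$ if $(\sum_{n=1}^N\|x_n\|^q)^{1/q}\le C(\mathbb{E}\|\sum_{n=1}^N\varepsilon_nx_n\|^2)^{1/2}$ for all finite sequences in $X$ (maximum on the left if $q=\infty$). $\mathcal{R}$-boundedness: $\mathcal{T}\subseteq\mathcal{L}(X,Y)$ is $\mathcal{R}$-bounded if there is $C>0$ with $\mathbb{E}\|\sum_{n=1}^N\varepsilon_nT_nx_n\|_Y\le C\,\mathbb{E}\|\sum_{n=1}^N\varepsilon_nx_n\|_X$ for all finite sequences $(T_n)$ in $\mathcal{T}$ and $(x_n)$ in $X$; the least such $C$ is $\mathcal{R}(\mathcal{T})$. Function spaces: let $E$ be a Banach space and $J\subseteq\mathbb{R}$ an interval. Functions are defined everywhere and $\|f\|_{L^\infty(J;E)}$ is read as $\sup_{x\in J}\|f(x)\|_E$. For $s\in[1,\infty)$, $[f]_{V^s(J;E)}:=\sup\big(\sum_{i=0}^{N-1}\|f(t_{i+1})-f(t_i)\|_E^s\big)^{1/s}$ over all finite increasing sequences $t_0<\dots<t_N$ in $J$, and $\|f\|_{V^s(J;E)}:=\|f\|_{L^\infty(J;E)}+[f]_{V^s(J;E)}$.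 For $s\in[1,\infty)$, an $R^s(J;E)$-atom is a function $a=\sum_{I\in\mathcal{I}}c_I\mathbf{1}_I$ on $J$, where $\mathcal{I}$ is a set of mutually disjoint subintervals of $J$, $c_I\in E$ and $(\sum_{I\in\mathcal{I}}\|c_I\|_E^s)^{1/s}\le1$. $R^s(J;E)$ is the space of all $f\in L^\infty(J;E)$ of the form $f=\sum_{k\ge1}\lambda_ka_k$ with $(\lambda_k)\in\ell^1$ and $R^s(J;E)$-atoms $a_k$, with $\|f\|_{R^s(J;E)}$ the infimum of $\|(\lambda_k)\|_{\ell^1}$ over all such representations; $R^\infty(J;E):=L^\infty(J;E)$. For $r\in[1,\infty]$ and $Z\in\{R,V\}$, $\ell^r(Z^s(\mathcal{J};E))$ consists of all bounded $f$ with $\|f\|_{\ell^r(Z^s(\mathcal{J};E))}:=\big(\sum_{J\in\mathcal{J}}\|f|_J\|_{Z^s(J;E)}^r\big)^{1/r}<\infty$ (supremum if $r=\infty$). Here $\operatorname{Ran}(f)$ is understood as $\bigcup_{J\in\mathcal{J}}f(J)$. *)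

(* Defs.v *)
From HB Require Import structures.
From mathcomp Require Export all_boot all_order all_algebra.
From mathcomp Require Export finmap.
From mathcomp Require Export all_classical all_reals all_analysis.
From mathcomp Require Export complex.

Set Implicit Arguments.
Unset Strict Implicit.
Unset Printing Implicit Defensive.

Import Order.TTheory GRing.Theory Num.Theory.
Export numFieldNormedType.Exports.

Local Open Scope classical_set_scope.
Local Open Scope complex_scope.
Local Open Scope ring_scope.

(* The norm of a complex normed module takes its values in R[i]; [rnorm] is
   the same norm as an element of R, see [rnormE]. *)
Definition rnorm (R : realType) (E : normedModType R[i]) (x : E) : R :=
  complex.Re `|x|.

Section rnorm_theory.
Context (R : realType) (E : normedModType R[i]).
Implicit Types x y : E.

Lemma rnormE x : `|x| = (rnorm x)%:C.
Proof. by rewrite /rnorm RRe_real// ger0_real. Qed.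

Lemma rnorm_ge0 x : 0 <= rnorm x.
Proof. by rewrite -ler0c -rnormE. Qed.

Lemma rnorm0 : rnorm (0 : E) = 0.
Proof. by rewrite /rnorm normr0. Qed.

Lemma rnorm0_eq0 x : rnorm x = 0 -> x = 0.
Proof. by move=> x0; apply/normr0_eq0; rewrite rnormE x0. Qed.

Lemma rnormD x y : rnorm (x + y) <= rnorm x + rnorm y.
Proof. by rewrite -lecR rmorphD/= -!rnormE ler_normD. Qed.

Lemma rnormZ (a : R[i]) x : rnorm (a *: x) = complex.Re `|a| * rnorm x.
Proof.
apply: complexI; rewrite rmorphM -rnormE normrZ; congr (_ * _).
exact: rnormE.
Qed.

End rnorm_theory.

Section bounded_linear_operators.
Context (R : realType) (X Y : normedModType R[i]).

Definition bounded_linear : {pred X -> Y} := fun T =>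
  `[< linear T /\ exists M : R, forall x, rnorm (T x) <= M * rnorm x >].

Lemma bounded_linearP (T : X -> Y) :
  reflect (linear T /\ exists M : R, forall x, rnorm (T x) <= M * rnorm x)
          (T \in bounded_linear).
Proof. exact: asboolP. Qed.

Lemma bounded_linear_submod_closed : submod_closed bounded_linear.
Proof.
split.
  apply/bounded_linearP; split.
    by move=> a x y; rewrite /= scaler0 addr0.
  by exists 0 => x; rewrite mul0r /= rnorm0.
move=> a S T /bounded_linearP[linS [M SM]] /bounded_linearP[linT [N TN]].
have aST x : (a *: S + T) x = a *: S x + T x by [].
apply/bounded_linearP; split.
  move=> b x y; rewrite !aST linS linT !scalerDr !scalerA (mulrC a).
  by rewrite addrACA.
exists (complex.Re `|a| * M + N) => x; rewrite aST.
rewrite (le_trans (rnormD _ _))// rnormZ mulrDl lerD// -mulrA ler_wpM2l//.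
by rewrite -ler0c RRe_real// ger0_real.
Qed.

HB.instance Definition _ := GRing.isSubmodClosed.Build R[i] (X -> Y)
  bounded_linear bounded_linear_submod_closed.

Record bounded_operator := BoundedOperator {
  operator_fun :> X -> Y;
  _ : operator_fun \in bounded_linear }.

HB.instance Definition _ := [isSub for operator_fun].
HB.instance Definition _ := [Choice of bounded_operator by <:].
HB.instance Definition _ :=
  [SubChoice_isSubLmodule of bounded_operator by <:].

Definition operator_norm (T : bounded_operator) : R :=
  sup [set rnorm (T x) | x in [set x | rnorm x <= 1]].

Implicit Types S T : bounded_operator.

Lemma operator_linear T : linear T.
Proof. by have /bounded_linearP[] := valP T. Qed.

HB.instance Definition _ T :=
  GRing.isLinear.Build R[i] X Y _ (operator_fun T) (operator_linear T).

Lemma operator_bounded T : exists M : R, forall x, rnorm (T x) <= M * rnorm x.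
Proof. by have /bounded_linearP[] := valP T. Qed.

Lemma operatorD S T x : (S + T) x = S x + T x.
Proof. by []. Qed.

Lemma operatorZ (a : R[i]) T x : (a *: T) x = a *: T x.
Proof. by []. Qed.

Lemma operator_fun0 x : (0 : bounded_operator) x = 0.
Proof. by []. Qed.

Let unit_ball_image T : set R :=
  [set rnorm (T x) | x in [set x | rnorm x <= 1]].

Let has_sup_unit_ball_image T : has_sup (unit_ball_image T).
Proof.
split.
  by exists (rnorm (T 0)), 0 => //=; rewrite rnorm0.
have [M TM] := operator_bounded T.
exists `|M| => _ [x /= x1 <-]; rewrite (le_trans (TM x))//.
rewrite (le_trans (ler_norm _))// normrM -[leRHS]mulr1 ler_wpM2l//.
by rewrite ger0_norm ?rnorm_ge0.
Qed.

Lemma operator_norm_ub T x : rnorm x <= 1 -> rnorm (T x) <= operator_norm T.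
Proof.
by move=> x1; apply: (sup_upper_bound (has_sup_unit_ball_image T)); exists x.
Qed.

Lemma operator_norm_le T (M : R) :
  (forall x, rnorm x <= 1 -> rnorm (T x) <= M) -> operator_norm T <= M.
Proof.
move=> TM; apply: ge_sup; first by have [] := has_sup_unit_ball_image T.
by move=> _ [x /= x1 <-]; exact: TM.
Qed.

Lemma operator_norm_ge0 T : 0 <= operator_norm T.
Proof.
by rewrite (le_trans (rnorm_ge0 (T 0)))// operator_norm_ub// rnorm0.
Qed.

Lemma operator_normP T x : rnorm (T x) <= operator_norm T * rnorm x.
Proof.
have [x0|x0] := eqVneq (rnorm x) 0.
  have [M TM] := operator_bounded T.
  by rewrite x0 mulr0 (le_trans (TM x))// x0 mulr0.
have nx0 : 0 < rnorm x by rewrite lt_neqAle eq_sym x0 rnorm_ge0.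
have re (a : R) : 0 <= a -> complex.Re `|a%:C| = a.
  by move=> a0; rewrite ger0_norm ?ler0c.
have {1}-> : x = (rnorm x)%:C *: ((rnorm x)^-1%:C *: x).
  by rewrite scalerA -rmorphM/= mulfV// scale1r.
set y := (_ *: x).
rewrite linearZ rnormZ re ?rnorm_ge0// mulrC ler_wpM2r ?rnorm_ge0//.
by rewrite operator_norm_ub// /y rnormZ re ?invr_ge0 ?rnorm_ge0// mulVf.
Qed.

Let norm T : R[i] := (operator_norm T)%:C.

Let normD S T : norm (S + T) <= norm S + norm T.
Proof.
rewrite /norm -rmorphD/= lecR; apply: operator_norm_le => x x1.
by rewrite operatorD (le_trans (rnormD _ _))// lerD// operator_norm_ub.
Qed.

Let normZ (a : R[i]) T : norm (a *: T) = `|a| * norm T.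
Proof.
have leZ b S : operator_norm (b *: S) <= complex.Re `|b| * operator_norm S.
  apply: operator_norm_le => x x1; rewrite operatorZ rnormZ ler_wpM2l//.
    by rewrite -ler0c RRe_real// ger0_real.
  exact: operator_norm_ub.
suff aT : operator_norm (a *: T) = complex.Re `|a| * operator_norm T.
  by rewrite /norm aT rmorphM.
apply/eqP; rewrite eq_le leZ andTb.
have [->|a0] := eqVneq a 0; first by rewrite normr0 mul0r operator_norm_ge0.
have na0 : 0 < complex.Re `|a| by rewrite -ltcR RRe_real ?ger0_real// normr_gt0.
have {1}-> : T = a^-1 *: (a *: T) by rewrite scalerA mulVf// scale1r.
rewrite -ler_pdivlMl// (le_trans (leZ _ _))// ler_wpM2r ?operator_norm_ge0//.
rewrite -lecR normfV; have -> : `|a| = (complex.Re `|a|)%:C.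
  by rewrite RRe_real// ger0_real.
by rewrite -fmorphV.
Qed.

Let norm0_eq0 T : norm T = 0 -> T = 0.
Proof.
move=> /complexI T0; apply/val_inj/funext => x; apply: rnorm0_eq0.
apply/eqP; rewrite eq_le rnorm_ge0 andbT.
by rewrite (le_trans (operator_normP T x))// T0 mul0r.
Qed.

HB.instance Definition _ := @Lmodule_isNormed.Build R[i] bounded_operator
  norm normD normZ norm0_eq0.

Lemma rnorm_operatorE T : rnorm T = operator_norm T.
Proof. by []. Qed.

End bounded_linear_operators.

Notation "''L' ( X , Y )" := (@bounded_operator _ X Y)
  (at level 8, X, Y at level 99, format "''L' ( X ,  Y )") : type_scope.

Section lp_quantities.
Context (R : realType).
Local Open Scope ereal_scope.

(* [ereal_sup set0 = -oo]; every supremum below is one of nonnegative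
   quantities, for which the supremum of the empty family is 0. *)
Definition sup0 (A : set (\bar R)) : \bar R := ereal_sup (0 |` A).

(* The junk value at -oo is irrelevant: exponents lie in [1, +oo]. *)
Definition ell_norm (p : \bar R) (I : choiceType) (A : set I)
    (a : I -> \bar R) : \bar R :=
  match p with
  | p%:E => (\esum_(i in A) a i `^ p) `^ p^-1
  | +oo => sup0 (a @` A)
  | -oo => 0
  end.

End lp_quantities.

Section rademacher.
Context (R : realType) (d : measure_display) (Omega : measurableType d)
        (P : probability Omega R).
Implicit Type eps : nat -> {RV P >-> R}.
Local Open Scope ereal_scope.

Definition mutually_independent eps :=
  forall (S : {fset nat}) (B : nat -> set R),
    (forall n, measurable (B n)) ->
    P (\bigcap_(n in [set` S]) (eps n @^-1` B n)) =
    \prod_(n <- S) P (eps n @^-1` B n).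

Definition rademacher eps :=
  [/\ forall n w, eps n w = 1%R \/ eps n w = (-1)%R,
      forall n, P (eps n @^-1` [set 1%R]) = (2^-1)%:E,
      forall n, P (eps n @^-1` [set (-1)%R]) = (2^-1)%:E &
      mutually_independent eps].

Definition rademacher_sum eps (E : normedModType R[i]) (N : nat)
    (x : 'I_N -> E) (w : Omega) : E :=
  (\sum_(n < N) (eps n w)%:C *: x n)%R.

Definition has_type eps (Y : normedModType R[i]) (t : R) :=
  exists C : R, forall (N : nat) (y : 'I_N -> Y),
    'E_P[fun w => (rnorm (rademacher_sum eps y w) ^+ 2)%R] `^ 2^-1 <=
    C%:E * ell_norm t%:E [set: 'I_N] (fun n => (rnorm (y n))%:E).

Definition has_cotype eps (X : normedModType R[i]) (q : \bar R) :=
  exists C : R, forall (N : nat) (x : 'I_N -> X),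
    ell_norm q [set: 'I_N] (fun n => (rnorm (x n))%:E) <=
    C%:E * 'E_P[fun w => (rnorm (rademacher_sum eps x w) ^+ 2)%R] `^ 2^-1.

Section R_boundedness.
Context (X Y : normedModType R[i]).

Definition R_bounded_by eps (TT : set 'L(X, Y)) (C : R) :=
  forall (N : nat) (T : 'I_N -> 'L(X, Y)) (x : 'I_N -> X),
    (forall n, TT (T n)) ->
    'E_P[fun w => rnorm (rademacher_sum eps (fun n => T n (x n)) w)] <=
    C%:E * 'E_P[fun w => rnorm (rademacher_sum eps x w)].

Definition R_bounded eps (TT : set 'L(X, Y)) :=
  exists2 C : R, (0 < C)%R & R_bounded_by eps TT C.

(* An infimum, since no least C > 0 exists when TT is contained in {0}. *)
Definition R_bound eps (TT : set 'L(X, Y)) : \bar R :=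
  ereal_inf [set C%:E | C in [set C : R | (0 < C)%R /\ R_bounded_by eps TT C]].

End R_boundedness.
End rademacher.

(* A function on a subset J of R is a total function on R whose values outside
   J are ignored by every notion below. *)
Section function_spaces.
Context (R : realType) (E : normedModType R[i]).
Implicit Types (J : set R) (f : R -> E) (s r : \bar R).
Local Open Scope ereal_scope.

Definition sup_norm J f : \bar R := sup0 [set (rnorm (f x))%:E | x in J].

Definition V_seminorm (s : R) J f : \bar R :=
  sup0 [set z | exists (N : nat) (tau : nat -> R),
    [/\ forall i, (i <= N)%N -> J (tau i),
        forall i, (i < N)%N -> (tau i < tau i.+1)%R &
        z = ((\sum_(i < N) rnorm (f (tau i.+1) - f (tau i))%R `^ s)%R `^ s^-1)%:E
    ]].

Definition V_norm (s : R) J f : \bar R := sup_norm J f + V_seminorm s J f.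

(* At each x at most one term of the sum over II is nonzero. *)
Definition R_atom (s : R) J (a : R -> E) :=
  exists (II : set (set R)) (c : set R -> E),
    [/\ forall I, II I -> is_interval I /\ I `<=` J,
        trivIset II id,
        ell_norm s%:E II (fun I => (rnorm (c I))%:E) <= 1 &
        forall x, J x -> a x = (\sum_(I \in II) (\1_I x : R[i]) *: c I)%R].

Definition ell1_norm (lam : nat -> R[i]) : \bar R :=
  \sum_(0 <= k <oo) (complex.Re `|lam k|)%:E.

(* Atoms are bounded by 1, so for lam in ell^1 the pointwise convergence below
   is the same as convergence in L^oo(J; E), and f is bounded on J. *)
Definition R_representation (s : R) J f (lam : nat -> R[i])
    (a : nat -> R -> E) :=
  [/\ forall k, R_atom s J (a k),
      ell1_norm lam < +oo &
      forall x, J x ->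
        (\sum_(0 <= k < n) lam k *: a k x)%R @[n --> \oo] --> f x].

(* The value is +oo exactly when f is not in R^s(J; E); exponents lie in
   [1, +oo]. *)
Definition R_norm s J f : \bar R :=
  match s with
  | s%:E => ereal_inf [set ell1_norm lam | lam in
              [set lam | exists a, R_representation s J f lam a]]
  | +oo => sup_norm J f
  | -oo => +oo
  end.

Implicit Types (JJ : set (set R)) (Z : set R -> (R -> E) -> \bar R).

Definition ellZ_norm r Z JJ f : \bar R := ell_norm r JJ (fun J => Z J f).

Definition in_ellZ r Z JJ f :=
  sup_norm (\bigcup_(J in JJ) J) f < +oo /\ ellZ_norm r Z JJ f < +oo.

Definition Ran JJ f : set E := \bigcup_(J in JJ) (f @` J).

End function_spaces.

Definition disjoint_intervals (R : realType) (JJ : set (set R)) :=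
  (forall J, JJ J -> is_interval J) /\ trivIset JJ id.

(* Main.v *)
Require Import Defs.
From mathcomp Require Import ring lra measurable_realfun.

Set Implicit Arguments.
Unset Strict Implicit.
Unset Printing Implicit Defensive.

Import Order.TTheory GRing.Theory Num.Theory.

Local Open Scope classical_set_scope.
Local Open Scope complex_scope.
Local Open Scope ring_scope.

(**
The R-bound of the range of an atom comes from a randomization. Let the
operators T_n take values c_I, I in a finite set, with the sum of |c_I|^r at
most K^r, and group a signed sum of the T_n x_n according to these values: it
becomes the sum of c_I u_I with u_I the sum of the eps_n x_n such that
T_n = c_I. As independent signs sigma_I may be inserted in front of the u_I
without changing any distribution, type t of Y, Holder's inequality with
1/t = 1/r + 1/q and cotype q of X, applied to the signs sigma_I for fixed eps,
give [keyed_multiplier]: the mean norm of the sum of the eps_n T_n x_n is at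
most C K times that of the sum of the eps_n x_n. Cotype speaks of quadratic
means and R-boundedness of means; [kahane_khintchine] reconciles them.
Everything takes place on the finite cube of sign patterns, because a mean over
Rademacher variables is an average over it ([expectation_sign_bits]).

A function f in ell^r(R^r) is, on each interval J, in the closed absolutely
convex hull of L_J times the atoms on J, for any L_J above the norm of f there.
Only finitely many intervals meet a given finite part of the range, and the mean
norm above is convex in the values taken on one interval. So these values may be
replaced by those of a multiple of a single atom, one interval at a time
([hybrid_family]); once this is done on all intervals, the operators form a
family as in the first paragraph, with K^r the sum of the L_J^r. This is
[ell_R_bounded_by]. If r is infinite, which forces t = q = 2, the first
paragraph applies with a group for each n ([sup_norm_R_bounded_by]).

A function of finite s-variation with s < r is in R^r ([R_norm_le_V_norm]). Let
w(x) be the s-variation, to the power s, up to x. The level sets of w at scale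
2^-n are about 2^n intervals, on each of which f oscillates by at most a
multiple of 2^(-n/s). Sampling f on them gives step functions converging to f;
the difference of consecutive ones has R^r norm at most a multiple of
2^(n/r) 2^(-n/s), which is summable.
*)

(** * Averages over the discrete cube *)

(** A point of the cube is a list of bits, [true] standing for the sign -1;
    with lists, induction on the dimension needs no reindexing. *)
Fixpoint cube (n : nat) : seq (seq bool) :=
  if n is m.+1 then map (cons true) (cube m) ++ map (cons false) (cube m)
  else [:: [::]].

Lemma mem_cube n s : (s \in cube n) = (size s == n).
Proof.
elim: n s => [|n IH] [|b s] //=; rewrite mem_cat.
  by apply/orP => -[] /mapP[].
rewrite eqSS -IH; apply/orP/idP => [[]/mapP[u us [_ ->]]//|sn].
by case: b; [left|right]; apply/map_f.
Qed.

Lemma uniq_cube n : uniq (cube n).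
Proof.
elim: n => //= n IH; rewrite cat_uniq !map_inj_uniq ?IH ?andbT/=; last 2 first.
- by move=> ? ? [].
- by move=> ? ? [].
by apply/hasPn => _ /mapP[s _ ->]; apply/negP => /mapP[].
Qed.

Section cube_average.
Context (R : realType).
Implicit Types (F G : seq bool -> R) (n : nat).

Definition cube_avg n F : R := 2^-1 ^+ n * \sum_(s <- cube n) F s.

Lemma cube_avg0 F : cube_avg 0 F = F [::].
Proof. by rewrite /cube_avg big_seq1 expr0 mul1r. Qed.

Lemma cube_avgS n F : cube_avg n.+1 F =
  (cube_avg n (fun s => F (true :: s)) + cube_avg n (fun s => F (false :: s)))
  / 2.
Proof. by rewrite /cube_avg /= big_cat !big_map/= exprS; field. Qed.

Lemma eq_cube_avg n F G : (forall s, size s = n -> F s = G s) ->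
  cube_avg n F = cube_avg n G.
Proof.
move=> FG; congr (_ * _); apply: eq_big_seq => s.
by rewrite mem_cube => /eqP/FG.
Qed.

Lemma le_cube_avg n F G : (forall s, size s = n -> F s <= G s) ->
  cube_avg n F <= cube_avg n G.
Proof.
move=> FG; rewrite ler_wpM2l ?exprn_ge0 ?invr_ge0//.
rewrite big_seq [leRHS]big_seq; apply: ler_sum => s.
by rewrite mem_cube => /eqP/FG.
Qed.

Lemma cube_avgD n F G :
  cube_avg n (fun s => F s + G s) = cube_avg n F + cube_avg n G.
Proof. by rewrite /cube_avg big_split/= mulrDr. Qed.

Lemma cube_avgZ n (c : R) F : cube_avg n (fun s => c * F s) = c * cube_avg n F.
Proof. by rewrite /cube_avg -mulr_sumr mulrCA. Qed.

Lemma cube_avg_cst n (c : R) : cube_avg n (fun=> c) = c.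
Proof.
by elim: n => [|n IH]; rewrite ?cube_avg0// cube_avgS IH; field.
Qed.

Lemma cube_avg_ge0 n F : (forall s, 0 <= F s) -> 0 <= cube_avg n F.
Proof.
by move=> F0; rewrite -(cube_avg_cst n 0); apply: le_cube_avg => s _.
Qed.

Lemma exchange_cube_avg n m (F : seq bool -> seq bool -> R) :
  cube_avg n (fun s => cube_avg m (F s)) =
  cube_avg m (fun u => cube_avg n (F ^~ u)).
Proof.
rewrite /cube_avg -!mulr_sumr mulrCA; congr (_ * (_ * _)).
exact: exchange_big.
Qed.

Lemma cube_avg_sum n I (r : seq I) (F : I -> seq bool -> R) :
  cube_avg n (fun s => \sum_(i <- r) F i s) = \sum_(i <- r) cube_avg n (F i).
Proof. by rewrite /cube_avg exchange_big mulr_sumr. Qed.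

Lemma cube_avg_sqr n F : (cube_avg n F) ^+ 2 <= cube_avg n (fun s => F s ^+ 2).
Proof.
set m := cube_avg n F.
have : 0 <= cube_avg n (fun s => (F s - m) ^+ 2).
  by apply: cube_avg_ge0 => s; exact: sqr_ge0.
have -> : cube_avg n (fun s => (F s - m) ^+ 2) =
    cube_avg n (fun s => F s ^+ 2 + (- (2 * m)) * F s + m ^+ 2).
  by apply: eq_cube_avg => s _; ring.
rewrite !cube_avgD cube_avgZ cube_avg_cst -/m; set a := cube_avg _ _.
by move=> h; nra.
Qed.

Lemma cube_avg_le_sqr n F : (forall s, 0 <= F s) ->
  cube_avg n F <= (cube_avg n (fun s => F s ^+ 2)) `^ 2^-1.
Proof.
move=> F0; rewrite powR12_sqrt; last first.
  by apply: cube_avg_ge0 => s; rewrite sqr_ge0.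
rewrite -[leLHS]ger0_norm ?cube_avg_ge0// -sqrtr_sqr ler_wsqrtr//.
exact: cube_avg_sqr.
Qed.

(** The group law of the cube, under which the average is invariant. *)
Definition flip (s u : seq bool) := [seq p.1 (+) p.2 | p <- zip s u].

Lemma size_flip s u : size s = size u -> size (flip s u) = size u.
Proof. by move=> su; rewrite size_map size2_zip// su. Qed.

Lemma nth_flip s u i : size s = size u ->
  nth false (flip s u) i = nth false s i (+) nth false u i.
Proof.
move=> su; have [iu|iu] := ltnP i (size u).
  rewrite (nth_map (false, false)) ?size2_zip ?su// ?nth_zip//.
by rewrite !nth_default ?size_flip ?su.
Qed.

Lemma cube_avg_flip n s F : size s = n ->
  cube_avg n (fun u => F (flip s u)) = cube_avg n F.
Proof.
elim: n s F => [|n IH] [|b s] F //= => [_|[sn]]; first by rewrite !cube_avg0.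
rewrite !cube_avgS.
rewrite (IH s (fun u => F (b (+) true :: u)))//.
rewrite (IH s (fun u => F (b (+) false :: u)))//.
by case: b => /=; rewrite // addrC.
Qed.

End cube_average.

(** * The Kahane-Khintchine inequality *)

Section kahane.
Context (R : realType).
Implicit Types (F G : seq bool -> R) (n : nat).

Definition sgn (b : bool) : R := (-1) ^+ b.

Lemma sgn_addb a b : sgn (a (+) b) = sgn a * sgn b.
Proof. exact: signr_addb. Qed.

Definition flip_bit (i : nat) (s : seq bool) :=
  set_nth false s i (~~ nth false s i).

(** This is the quadratic form <F, L F> of the Laplacian
    L F = 1/2 sum_i (F - F o flip_bit i) of the cube; the eigenvalue of L on a
    Walsh function is its degree. *)
Definition energy n F : R :=
  4^-1 * \sum_(i < n) cube_avg n (fun s => (F s - F (flip_bit i s)) ^+ 2).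

Lemma energyS n F (Ft := fun s => F (true :: s)) (Ff := fun s => F (false :: s)) :
  energy n.+1 F = (energy n Ft + energy n Ff) / 2 +
                  cube_avg n (fun s => ((Ft s - Ff s) / 2) ^+ 2).
Proof.
rewrite /energy big_ord_recl cube_avgS /=.
have -> : cube_avg n (fun s => (F (true :: s) - F (false :: s)) ^+ 2) =
    4 * cube_avg n (fun s => ((Ft s - Ff s) / 2) ^+ 2).
  by rewrite -cube_avgZ; apply: eq_cube_avg => s _; rewrite /Ft/Ff; field.
have -> : cube_avg n (fun s => (F (false :: s) - F (true :: s)) ^+ 2) =
    4 * cube_avg n (fun s => ((Ft s - Ff s) / 2) ^+ 2).
  by rewrite -cube_avgZ; apply: eq_cube_avg => s _; rewrite /Ft/Ff; field.
under eq_bigr do rewrite cube_avgS /=.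
rewrite -mulr_suml big_split/= -/Ft -/Ff.
by rewrite /Ft /Ff; field.
Qed.

Lemma energy_half n F G : (energy n F + energy n G) / 2 =
  energy n (fun s => (F s + G s) / 2) + energy n (fun s => (F s - G s) / 2).
Proof.
rewrite /energy -!mulrDr -mulrA; congr (_ * _).
rewrite -!big_split/= mulr_suml; apply: eq_bigr => i _.
rewrite -!cube_avgD mulrC -cube_avgZ; apply: eq_cube_avg => s _.
by field.
Qed.

(** Orthogonal decomposition along the first coordinate:
    F (e :: s) = a s - sgn e * b s. *)
Lemma cube_avg_half n F (a := fun s => (F (true :: s) + F (false :: s)) / 2)
    (b := fun s => (F (true :: s) - F (false :: s)) / 2) :
  [/\ cube_avg n.+1 F = cube_avg n a,
      cube_avg n.+1 (fun s => F s ^+ 2) =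
        cube_avg n (fun s => a s ^+ 2) + cube_avg n (fun s => b s ^+ 2),
      energy n.+1 F = energy n a + energy n b + cube_avg n (fun s => b s ^+ 2) &
      \sum_(i < n.+1) (cube_avg n.+1 (fun s => sgn (nth false s i) * F s)) ^+ 2 =
      cube_avg n b ^+ 2 +
      \sum_(i < n) (cube_avg n (fun s => sgn (nth false s i) * a s)) ^+ 2].
Proof.
split.
- rewrite cube_avgS -cube_avgD mulrC -cube_avgZ; apply: eq_cube_avg => s _.
  by rewrite /a; field.
- rewrite cube_avgS -!cube_avgD mulrC -cube_avgZ; apply: eq_cube_avg => s _.
  by rewrite /a/b; field.
- by rewrite energyS energy_half.
- rewrite big_ord_recl; congr (_ + _).
    rewrite cube_avgS -!cube_avgD mulrC -cube_avgZ -sqrrN; congr (_ ^+ 2).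
    rewrite -[LHS]mulN1r -cube_avgZ; apply: eq_cube_avg => s _.
    by rewrite /b /sgn /= expr1 expr0; field.
  apply: eq_bigr => i _; congr (_ ^+ 2).
  rewrite cube_avgS -!cube_avgD mulrC -cube_avgZ; apply: eq_cube_avg => s _.
  by rewrite /a /=; field.
Qed.

(** The mean of b ^ 2, by which the variance of F exceeds that of a, is also
    the contribution of the first coordinate to the energy. *)
Lemma poincare n F :
  cube_avg n (fun s => F s ^+ 2) - (cube_avg n F) ^+ 2 <= energy n F.
Proof.
elim: n F => [|n IH] F.
  by rewrite /energy big_ord0 mulr0 !cube_avg0 subrr.
have [-> -> -> _] := cube_avg_half n F.
set a := fun s => (F (true :: s) + _) / 2; set b := fun s => (F (true :: s) - _) / 2.
have := IH a; have : 0 <= energy n b.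
  rewrite mulr_ge0 ?invr_ge0// sumr_ge0// => i _.
  by apply: cube_avg_ge0 => s; exact: sqr_ge0.
by lra.
Qed.

(** Once the part of degree 1 is added back, only Walsh functions of degree at
    least 2 remain, which doubles the constant of the Poincare inequality. *)
Lemma poincare_degree2 n F :
  2 * (cube_avg n (fun s => F s ^+ 2) - (cube_avg n F) ^+ 2) <=
  energy n F +
  \sum_(i < n) (cube_avg n (fun s => sgn (nth false s i) * F s)) ^+ 2.
Proof.
elim: n F => [|n IH] F.
  by rewrite /energy !big_ord0 mulr0 !cube_avg0 subrr mulr0 addr0.
have [-> -> -> ->] := cube_avg_half n F.
set a := fun s => (F (true :: s) + _) / 2; set b := fun s => (F (true :: s) - _) / 2.
have := IH a; have := poincare n b.
set A1 := cube_avg n _; set A2 := cube_avg n _; set A3 := cube_avg n _.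
set S := \sum_(i < n) _; set A4 := cube_avg n a.
by lra.
Qed.

Lemma cube_avg_flip_bit n F (i : 'I_n) :
  cube_avg n (fun s => F (flip_bit i s)) = cube_avg n F.
Proof.
elim: n F i => [F []//|n IH] F i; rewrite !cube_avgS.
case: (unliftP ord0 i) => [j|] -> /=; first by rewrite !(IH (fun s => F (_ :: s))).
by rewrite addrC.
Qed.

Lemma energyE n F : energy n F = 2^-1 *
  (n%:R * cube_avg n (fun s => F s ^+ 2) -
   cube_avg n (fun s => F s * \sum_(i < n) F (flip_bit i s))).
Proof.
rewrite (@eq_cube_avg _ _ (fun s => F s * _)
  (fun s => \sum_(i < n) F s * F (flip_bit i s))); last first.
  by move=> s _; rewrite mulr_sumr.
rewrite cube_avg_sum; set A2 := cube_avg n _.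
have -> : n%:R * A2 = \sum_(i < n) A2 by rewrite sumr_const card_ord mulr_natl.
rewrite -sumrB.
rewrite /energy !mulr_sumr; apply: eq_bigr => i _.
set A := cube_avg n _; set C := cube_avg n _.
suff -> : A = A2 - 2 * C + A2 by field.
rewrite /A /A2 /C -{2}(cube_avg_flip_bit (fun s => F s ^+ 2) i) -mulNr -cube_avgZ -!cube_avgD.
by apply: eq_cube_avg => s _; ring.
Qed.

End kahane.

Section signed_sum.
Context (R : realType) (E : normedModType R[i]).

Definition signed_sum N (x : 'I_N -> E) (s : seq bool) : E :=
  \sum_(n < N) (sgn R (nth false s n))%:C *: x n.

Lemma rnormN (x : E) : rnorm (- x) = rnorm x.
Proof. by rewrite /rnorm normrN. Qed.

Lemma rnormZR (a : R) (x : E) : rnorm (a%:C *: x) = `|a| * rnorm x.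
Proof. by rewrite rnormZ normc_def /= expr0n/= addr0 sqrtr_sqr. Qed.

Lemma scaleC_M (a b : R) (x : E) : (a * b)%:C *: x = a%:C *: (b%:C *: x).
Proof. by rewrite rmorphM scalerA. Qed.

Lemma rnorm_sum I (r : seq I) (P : pred I) (x : I -> E) :
  rnorm (\sum_(i <- r | P i) x i) <= \sum_(i <- r | P i) rnorm (x i).
Proof.
elim/big_ind2 : _ => [|x1 x2 y1 y2 h1 h2|//]; first by rewrite rnorm0.
by rewrite (le_trans (rnormD _ _))// lerD.
Qed.

Lemma signed_sum_flip_bit N (x : 'I_N -> E) s (i : 'I_N) :
  signed_sum x (flip_bit i s) =
  signed_sum x s - (2 * sgn R (nth false s i))%:C *: x i.
Proof.
rewrite /signed_sum (bigD1 i)//= [X in _ = X - _](bigD1 i)//= addrAC.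
congr (_ + _).
  rewrite nth_set_nth/= eqxx -scalerBl -rmorphB/=; congr (_%:C *: _).
  by case: nth; rewrite /sgn /= ?expr1 ?expr0; ring.
apply: eq_bigr => j ji; rewrite nth_set_nth/= ifN//.
Qed.

(** Proof of Latala and Oleszkiewicz: the norm f of a signed sum is even, so it
    has no part of degree 1, and L f <= f by the triangle inequality. Hence
    twice the variance of f is at most <F, L F> for F = f, which is at most the
    mean of f ^ 2. *)
Lemma kahane_khintchine N (x : 'I_N -> E) :
  cube_avg N (fun s => rnorm (signed_sum x s) ^+ 2) <=
  2 * (cube_avg N (fun s => rnorm (signed_sum x s))) ^+ 2.
Proof.
set f := fun s => rnorm (signed_sum x s).
have f0 s : 0 <= f s by exact: rnorm_ge0.
have fN s : size s = N -> f (flip (nseq N true) s) = f s.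
  move=> sN; rewrite /f -rnormN; congr rnorm.
  rewrite /signed_sum -sumrN; apply: eq_bigr => i _.
  rewrite nth_flip ?size_nseq// nth_nseq ltn_ord sgn_addb /sgn expr1 mulN1r.
  by rewrite rmorphN/= scaleNr opprK.
(* The part of degree 1 vanishes by symmetry. *)
have f1 (i : 'I_N) : cube_avg N (fun s => sgn R (nth false s i) * f s) = 0.
  have := cube_avg_flip (fun s => sgn R (nth false s i) * f s) (size_nseq N true).
  set A := cube_avg _ _; set B := cube_avg _ _.
  suff -> : A = - B by lra.
  rewrite /A /B -[RHS]mulN1r -cube_avgZ; apply: eq_cube_avg => s sN.
  by rewrite nth_flip ?size_nseq// nth_nseq ltn_ord sgn_addb fN// /sgn expr1 mulrA.
(* This is L f <= f. *)
have fL s : N%:R * f s - 2 * f s <= \sum_(i < N) f (flip_bit i s).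
  rewrite -mulrBl; apply: le_trans (rnorm_sum _ _ _).
  under eq_bigr do rewrite signed_sum_flip_bit.
  rewrite sumrB sumr_const card_ord -[signed_sum x s *+ N]scaler_nat.
  under eq_bigr do rewrite scaleC_M.
  rewrite -scaler_sumr -/(signed_sum x s) -scalerBl.
  rewrite (_ : N%:R - 2%:C = (N%:R - 2)%:C).
    by rewrite rnormZR ler_wpM2r// ler_norm.
  by rewrite -(rmorph_nat (@real_complex R)) -rmorphB.
have := poincare_degree2 N f; under eq_bigr do rewrite f1 expr0n/=.
rewrite sumr_const mul0rn addr0 energyE.
set A := cube_avg N _; set B := cube_avg N f; set C := cube_avg N _.
have : N%:R * A - 2 * A <= C.
  rewrite /A /C -mulrBl -cube_avgZ; apply: le_cube_avg => s _.
  by rewrite expr2 mulrCA ler_wpM2l// mulrBl.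
by lra.
Qed.

End signed_sum.

(** * Rademacher sequences and the discrete cube *)

Section rademacher_cube.
Context (R : realType) (d : measure_display) (Omega : measurableType d)
        (P : probability Omega R) (eps : nat -> {RV P >-> R}).
Hypothesis heps : rademacher eps.

Definition sign_bits N (w : Omega) : seq bool :=
  mkseq (fun n => eps n w == -1) N.

Lemma size_sign_bits N w : size (sign_bits N w) = N.
Proof. exact: size_mkseq. Qed.

Let eq1N1 : (1 == -1 :> R) = false.
Proof. by apply/negbTE/eqP => h; lra. Qed.

Lemma rademacher_sumE (E : normedModType R[i]) N (x : 'I_N -> E) w :
  rademacher_sum eps x w = signed_sum x (sign_bits N w).
Proof.
have [eps1 _ _ _] := heps.
apply: eq_bigr => n _; rewrite nth_mkseq//; congr (_%:C *: _).
have [->|->] := eps1 n w; rewrite ?eqxx /sgn ?expr1//.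
by rewrite eq1N1 expr0.
Qed.

Let cell N (s : seq bool) : set Omega := [set w | sign_bits N w = s].

Let initial_segment N :
  exists2 S : {fset nat}, S =i [pred n | n < N]%N & size S = N.
Proof.
exists (seq_fset tt (iota 0 N)).
  by move=> n; rewrite seq_fsetE mem_iota add0n.
by rewrite size_seq_fset undup_id ?iota_uniq// size_iota.
Qed.

Let cellE N s (S : {fset nat}) : S =i [pred n | n < N]%N -> size s = N ->
  cell N s = \bigcap_(n in [set` S]) (eps n @^-1` [set sgn R (nth false s n)]).
Proof.
have [eps1 _ _ _] := heps.
move=> SN sN; apply/seteqP; split => w /=.
  move=> <- n /=; rewrite SN inE /= => nN.
  rewrite nth_mkseq//; have [->|->] := eps1 n w; rewrite ?eqxx ?eq1N1 /sgn ?expr1//.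
move=> h; apply: (@eq_from_nth _ false); first by rewrite size_mkseq.
rewrite size_mkseq => n nN; rewrite nth_mkseq//.
have /h /= -> : n \in S by rewrite SN.
by case: nth; rewrite /sgn ?expr1 ?expr0 ?eqxx ?eq1N1.
Qed.

Let measurable_cell N s : size s = N -> measurable (cell N s).
Proof.
have [S SN _] := initial_segment N.
move=> sN; rewrite (cellE SN)//; exact: fin_bigcap_measurable.
Qed.

Let P_cell N s : size s = N -> P (cell N s) = (2^-1 ^+ N)%:E.
Proof.
have [_ eps1 epsN1 ind] := heps.
have [S SN SzN] := initial_segment N.
move=> sN; rewrite (cellE SN)// (ind _ (fun n => [set sgn R (nth false s n)]))//.
transitivity (\prod_(n <- S) (2^-1 : R)%:E)%E.
  apply: eq_bigr => n _.
  by case: nth; rewrite /sgn ?expr1 ?expr0.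
rewrite prodEFin; congr EFin.
by rewrite big_const_seq count_predT SzN iter_mulr_1.
Qed.

(** A function of the first N Rademacher variables takes the value at each of
    the 2 ^ N sign patterns on an event of probability 2 ^- N. *)
Lemma expectation_sign_bits N (G : seq bool -> R) : (forall s, 0 <= G s) ->
  'E_P[fun w => G (sign_bits N w)]%E = (cube_avg N G)%:E.
Proof.
move=> G0; rewrite unlock.
transitivity (\int[P]_w \sum_(s <- cube N) (G s)%:E * (\1_(cell (size s) s) w)%:E)%E.
  apply: eq_integral => w _.
  rewrite (bigD1_seq (sign_bits N w)) ?uniq_cube ?mem_cube ?size_sign_bits//=.
  rewrite indicE mem_set// mule1 big1_seq ?adde0// => s /andP[ns].
  rewrite mem_cube => /eqP sN; rewrite indicE memNset ?mule0// sN /cell/= => h.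
  by rewrite h eqxx in ns.
rewrite ge0_integral_sum//; last 2 first.
- move=> s; apply/measurable_EFinP/measurable_funM => //.
  exact: measurable_indic (measurable_cell _).
- by move=> s w _; rewrite mule_ge0 ?lee_fin.
rewrite big_seq (eq_bigr (fun s => (2^-1 ^+ N * G s)%:E)); last first.
  move=> s; rewrite mem_cube => /eqP sN.
  rewrite ge0_integralZl//; first last.
  - by rewrite lee_fin.
  - apply/measurable_EFinP; exact: measurable_indic (measurable_cell _).
  rewrite sN integral_indic ?setIT//; last exact: measurable_cell.
  by rewrite EFinM muleC; congr (_ * _)%E; exact: P_cell.
by rewrite -big_seq sumEFin -mulr_sumr.
Qed.

Lemma expectation_rademacher_sum (E : normedModType R[i]) N (x : 'I_N -> E) :
  'E_P[fun w => rnorm (rademacher_sum eps x w)]%E =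
  (cube_avg N (fun s => rnorm (signed_sum x s)))%:E.
Proof.
under eq_fun do rewrite rademacher_sumE.
apply: (@expectation_sign_bits N (fun s => rnorm (signed_sum x s))) => s.
exact: rnorm_ge0.
Qed.

Lemma expectation_rademacher_sum_sqr (E : normedModType R[i]) N (x : 'I_N -> E) :
  'E_P[fun w => (rnorm (rademacher_sum eps x w) ^+ 2)%R]%E =
  (cube_avg N (fun s => rnorm (signed_sum x s) ^+ 2))%:E.
Proof.
under eq_fun do rewrite rademacher_sumE.
apply: (@expectation_sign_bits N (fun s => rnorm (signed_sum x s) ^+ 2)) => s.
exact: sqr_ge0.
Qed.

End rademacher_cube.

(** * Holder's inequality for finite families *)

Section ell_le.
Context (R : realType).

(** The ball of radius K of ell^p, in a form without p-th roots, for which the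
    bounds K ^ p of several families add up. *)
Definition ell_le (p : \bar R) (I : eqType) (s : seq I) (a : I -> R) (K : R) :
    Prop :=
  match p with
  | p%:E => \sum_(i <- s) a i `^ p <= K `^ p
  | +oo%E => {in s, forall i, a i <= K}
  | -oo%E => False
  end.

Lemma powRVK (x p : R) : 0 <= x -> p != 0 -> (x `^ p^-1) `^ p = x.
Proof. by move=> x0 p0; rewrite -powRrM mulVf// powRr1. Qed.

Lemma powRKV (x p : R) : 0 <= x -> p != 0 -> (x `^ p) `^ p^-1 = x.
Proof. by move=> x0 p0; rewrite -powRrM mulfV// powRr1. Qed.

Lemma ler_powR2 (p x y : R) : 0 <= p -> 0 <= x -> x <= y -> x `^ p <= y `^ p.
Proof.
by move=> p0 x0 xy; rewrite ge0_ler_powR// nnegrE// (le_trans x0).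
Qed.

Lemma lee_poweR2 (p : R) (x y : \bar R) : 0 <= p -> (0 <= x)%E -> (x <= y)%E ->
  (x `^ p <= y `^ p)%E.
Proof.
move=> p0 x0 xy; apply: gt0_ler_poweR => //.
  by rewrite in_itv/= x0 leey.
by rewrite in_itv/= leey andbT (le_trans x0).
Qed.

Lemma sum_le_esum (I : choiceType) (A : set I) (s : seq I) (b : I -> \bar R) :
  uniq s -> (forall i, i \in s -> A i) ->
  (\sum_(i <- s) b i <= \esum_(i in A) b i)%E.
Proof.
move=> us sA; apply: esum_ge; exists [set` s]; last by rewrite -fsbig_seq.
by split => //; exact: finite_seq.
Qed.

Lemma ell_norm_le (p : \bar R) (I : choiceType) (A : set I) (s : seq I)
    (a : I -> R) (b : I -> \bar R) (K : R) : (1 <= p)%E -> 0 <= K ->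
  uniq s -> (forall i, i \in s -> A i) ->
  (forall i, i \in s -> 0 <= a i) -> (forall i, i \in s -> (a i)%:E <= b i)%E ->
  (ell_norm p A b <= K%:E)%E -> ell_le p s a K.
Proof.
move=> + K0 us sA a0 ab; case: p => [p| |]//=.
  rewrite lee_fin => p1 h.
  have p0 : 0 < p by rewrite (lt_le_trans _ p1).
  rewrite -lee_fin -sumEFin.
  apply: (@le_trans _ _ (\sum_(i <- s) b i `^ p)%E).
    rewrite big_seq [leRHS]big_seq; apply: lee_sum => i si.
    rewrite -poweR_EFin; apply: lee_poweR2; [exact: ltW| |exact: ab].
    by rewrite lee_fin a0.
  apply: le_trans (sum_le_esum _ us sA) _.
  have e0 : (0 <= \esum_(i in A) b i `^ p)%E.
    by apply: esum_ge0 => i _; exact: poweR_ge0.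
  have := lee_poweR2 (ltW p0) (poweR_ge0 _ _) h.
  by rewrite -poweRrM mulVf ?gt_eqF// poweRe1// poweR_EFin.
move=> _ h i si; rewrite -lee_fin (le_trans (ab i si))// (le_trans _ h)//.
by apply: ereal_sup_ubound; right; exists i => //; exact: sA.
Qed.

Lemma ell_norm_ord (p : R) N (a : 'I_N -> R) : (forall i, 0 <= a i) ->
  ell_norm p%:E [set: 'I_N] (fun i => (a i)%:E) =
  ((\sum_(i < N) a i `^ p) `^ p^-1)%:E.
Proof.
move=> a0; rewrite /ell_norm -poweR_EFin; congr (_ `^ _)%E.
rewrite esum_fset; [|exact: finite_finset|by move=> i _; exact: poweR_ge0].
rewrite -sumEFin -[RHS]big_enum/= [RHS]fsbig_seq ?enum_uniq//=.
apply: eq_fsbigl; apply/seteqP; split => // i _ /=.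
by rewrite mem_enum.
Qed.

Lemma ell_le_hoelder_fin (p q r : R) (I : eqType) (s : seq I) (a b : I -> R) A B :
  0 < p -> 0 < q -> 0 < r -> r^-1 = p^-1 + q^-1 ->
  (forall i, 0 <= a i) -> (forall i, 0 <= b i) -> 0 < A -> 0 < B ->
  ell_le p%:E s a A -> ell_le q%:E s b B ->
  ell_le r%:E s (fun i => a i * b i) (A * B).
Proof.
move=> p0 q0 r0 rpq a0 b0 A0 B0 /= aA bB.
have r_conj : (p / r)^-1 + (q / r)^-1 = 1.
  by rewrite !invf_div -mulrDr -rpq mulfV// gt_eqF.
(* Young's inequality for the families a / A and b / B. *)
have young i : (a i * b i) `^ r <=
    (A * B) `^ r * (r / p * (a i `^ p / A `^ p) + r / q * (b i `^ q / B `^ q)).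
  have pw (x X e : R) : 0 <= x -> 0 < X -> ((x / X) `^ r) `^ (e / r) = x `^ e / X `^ e.
    move=> x0 X0; rewrite -powRrM mulrCA mulfV ?gt_eqF// mulr1.
    by rewrite powRM ?invr_ge0 ?(ltW X0)// -powR_inv1 ?(ltW X0)// -powRrM mulN1r powRN.
  have := @conjugate_powR _ ((a i / A) `^ r) ((b i / B) `^ r) (p / r) (q / r)
    (powR_ge0 _ _) (powR_ge0 _ _) (divr_gt0 p0 r0) (divr_gt0 q0 r0) r_conj.
  rewrite !pw// -powRM ?divr_ge0 ?(ltW A0) ?(ltW B0)// => h.
  have -> : a i * b i = A * B * (a i / A * (b i / B)).
    by field; rewrite !gt_eqF.
  rewrite powRM ?mulr_ge0 ?invr_ge0 ?(ltW A0) ?(ltW B0)//.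
  rewrite ler_wpM2l ?powR_ge0//; apply: le_trans h _.
  rewrite !invf_div; by rewrite [_ * (r / p)]mulrC [_ * (r / q)]mulrC.
apply: le_trans (ler_sum _ (fun i _ => young i)) _.
rewrite -mulr_sumr big_split/= -!mulr_sumr -!mulr_suml.
rewrite -[leRHS]mulr1 ler_wpM2l ?powR_ge0// -r_conj !invf_div.
by rewrite lerD// ger_pMr ?divr_gt0// ler_pdivrMr ?powR_gt0// mul1r.
Qed.

(** When one of p and q is infinite, the other one equals r. *)
Lemma ell_le_hoelder (p q : \bar R) (r : R) (I : eqType) (s : seq I)
    (a b : I -> R) A B :
  (1 <= p)%E -> (1 <= q)%E -> 1 <= r -> (p^-1 = r%:E^-1 - q^-1)%E ->
  (forall i, 0 <= a i) -> (forall i, 0 <= b i) -> 0 < A -> 0 < B ->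
  ell_le p s a A -> ell_le q s b B ->
  ell_le r%:E s (fun i => a i * b i) (A * B).
Proof.
move=> p1 q1 r1; have r0 : 0 < r by rewrite (lt_le_trans _ r1).
rewrite [in _%:E^-1%E]inver gt_eqF//.
case: p p1 => [p| |]//; rewrite ?lee_fin => p1;
  case: q q1 => [q| |]//; rewrite ?lee_fin => q1.
- have p0 : 0 < p by rewrite (lt_le_trans _ p1).
  have q0 : 0 < q by rewrite (lt_le_trans _ q1).
  rewrite !inver !gt_eqF// -EFinB => -[pqr] a0 b0 A0 B0.
  by apply: ell_le_hoelder_fin => //; rewrite pqr; ring.
- have p0 : 0 < p by rewrite (lt_le_trans _ p1).
  rewrite invey sube0 inver gt_eqF// => -[/invr_inj ->] a0 b0 A0 B0 /= aA bB.
  apply: (@le_trans _ _ (\sum_(i <- s) a i `^ r * B `^ r)).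
    rewrite big_seq [leRHS]big_seq; apply: ler_sum => i si.
    by rewrite -powRM ?(ltW B0)// ler_powR2 ?mulr_ge0 ?(ltW r0)// ler_wpM2l ?bB.
  by rewrite -mulr_suml powRM ?(ltW A0) ?(ltW B0)// ler_wpM2r ?powR_ge0.
- have q0 : 0 < q by rewrite (lt_le_trans _ q1).
  rewrite invey inver gt_eqF// -EFinB => -[/eqP].
  rewrite eq_sym subr_eq0 => /eqP/invr_inj ->.
  move=> a0 b0 A0 B0 /= aA bB.
  apply: (@le_trans _ _ (\sum_(i <- s) A `^ q * b i `^ q)).
    rewrite big_seq [leRHS]big_seq; apply: ler_sum => i si.
    by rewrite -powRM ?(ltW A0)// ler_powR2 ?mulr_ge0 ?(ltW q0)// ler_wpM2r ?aA.
  by rewrite -mulr_sumr powRM ?(ltW A0) ?(ltW B0)// ler_wpM2l ?powR_ge0.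
- rewrite invey sube0 => -[/eqP]; rewrite eq_sym invr_eq0 => /eqP r00.
  by move: r0; rewrite r00 ltxx.
Qed.

End ell_le.

(** * Type, cotype and families with few values *)

Section type_cotype.
Context (R : realType) (d : measure_display) (Omega : measurableType d)
        (P : probability Omega R) (eps : nat -> {RV P >-> R}).
Hypothesis heps : rademacher eps.

Lemma has_type_cube_avg (Y : normedModType R[i]) (t : R) : 1 <= t ->
  has_type eps Y t ->
  exists2 C, 0 < C & forall N (y : 'I_N -> Y) K, 0 <= K ->
    ell_le t%:E (enum 'I_N) (fun n => rnorm (y n)) K ->
    cube_avg N (fun s => rnorm (signed_sum y s)) <= C * K.
Proof.
move=> t1 [C hC]; have t0 : 0 < t by rewrite (lt_le_trans _ t1).
have C1 : C <= `|C| + 1 by rewrite (le_trans (ler_norm _))// lerDl.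
exists (`|C| + 1) => [|N y K K0 /= yK]; first by rewrite ltr_wpDl.
have := hC N y; rewrite expectation_rademacher_sum_sqr//.
rewrite ell_norm_ord; last by move=> i; exact: rnorm_ge0.
rewrite poweR_EFin -EFinM lee_fin => h.
apply: (le_trans (cube_avg_le_sqr _ _)); first by move=> s; exact: rnorm_ge0.
apply: (le_trans h); apply: le_trans (ler_wpM2r (powR_ge0 _ _) C1) _.
rewrite big_enum/= in yK.
have tN0 : t != 0 by rewrite gt_eqF.
rewrite ler_wpM2l ?addr_ge0// -[leRHS](powRKV K0 tN0).
by rewrite ler_powR2 ?invr_ge0 ?(ltW t0)// sumr_ge0// => i _; exact: powR_ge0.
Qed.

(** The factor 2 covers the square root of 2 lost when the quadratic mean is
    replaced by the mean. *)
Lemma has_cotype_cube_avg (X : normedModType R[i]) (q : \bar R) : (1 <= q)%E ->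
  has_cotype eps X q ->
  exists2 C, 0 < C & forall N (x : 'I_N -> X),
    ell_le q (enum 'I_N) (fun n => rnorm (x n))
      (C * cube_avg N (fun s => rnorm (signed_sum x s))).
Proof.
move=> q1 [C hC]; exists ((`|C| + 1) * 2) => [|N x].
  by rewrite mulr_gt0// ltr_wpDl.
have a0 : 0 <= cube_avg N (fun s => rnorm (signed_sum x s)).
  by apply: cube_avg_ge0 => s; exact: rnorm_ge0.
have a20 : 0 <= cube_avg N (fun s => rnorm (signed_sum x s) ^+ 2).
  by apply: cube_avg_ge0 => s; exact: sqr_ge0.
have C1 : C <= `|C| + 1 by rewrite (le_trans (ler_norm _))// lerDl.
apply: (@ell_norm_le _ _ _ [set: 'I_N] _ _ (fun n => (rnorm (x n))%:E)) => //.
- by apply: mulr_ge0 => //; rewrite mulr_ge0// addr_ge0.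
- exact: enum_uniq.
- by move=> i _; exact: rnorm_ge0.
apply: (le_trans (hC N x)); rewrite expectation_rademacher_sum_sqr//.
rewrite poweR_EFin -EFinM lee_fin -mulrA.
apply: le_trans (ler_wpM2r (powR_ge0 _ _) C1) _; rewrite ler_wpM2l ?addr_ge0//.
have a2 := mulr_ge0 (ler0n R 2) a0.
rewrite powR12_sqrt// -[leRHS](ger0_norm a2) -sqrtr_sqr ler_wsqrtr//.
apply: le_trans (kahane_khintchine x) _.
by rewrite [(2 * _) ^+ 2]exprMn ler_wpM2r ?sqr_ge0// -natrX ler_nat.
Qed.

End type_cotype.

Lemma le_ell_le (R : realType) (p : \bar R) (I : eqType) (s : seq I)
    (a b : I -> R) (K : R) : (1 <= p)%E -> (forall i, 0 <= a i <= b i) ->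
  ell_le p s b K -> ell_le p s a K.
Proof.
case: p => [p| |]//=; rewrite ?lee_fin => p1 ab bK.
  apply: le_trans bK; apply: ler_sum => i _; have /andP[a0 ?] := ab i.
  by rewrite ler_powR2// (le_trans _ p1).
by move=> i si; have /andP[_ abi] := ab i; rewrite (le_trans abi)// bK.
Qed.

Section grouping.
Context (R : realType) (E : normedModType R[i]) (N M : nat) (g : 'I_N -> 'I_M).

Definition group_sum (z : 'I_N -> E) (s : seq bool) (i : 'I_M) : E :=
  \sum_(n < N | g n == i) (sgn R (nth false s n))%:C *: z n.

Let pull (sigma : seq bool) := [seq nth false sigma (g n) | n <- enum 'I_N].

Let size_pull sigma : size (pull sigma) = N.
Proof. by rewrite size_map size_enum_ord. Qed.

Let nth_pull sigma (n : 'I_N) : nth false (pull sigma) n = nth false sigma (g n).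
Proof. by rewrite (nth_map n) ?nth_ord_enum// size_enum_ord. Qed.

Let signed_sum_pull (z : 'I_N -> E) s sigma : size s = N ->
  signed_sum z (flip (pull sigma) s) = signed_sum (group_sum z s) sigma.
Proof.
move=> sN; rewrite /signed_sum (partition_big g xpredT)//=.
apply: eq_bigr => i _; rewrite scaler_sumr; apply: eq_bigr => n /eqP <-.
by rewrite nth_flip ?size_pull// nth_pull sgn_addb scaleC_M.
Qed.

(** Signs that are constant on the fibres of g may be inserted into a signed
    sum, which is then randomized over the groups. *)
Lemma cube_avg_group (z : 'I_N -> E) :
  cube_avg N (fun s => rnorm (signed_sum z s)) =
  cube_avg N (fun s => cube_avg M (fun sigma =>
    rnorm (signed_sum (group_sum z s) sigma))).
Proof.
rewrite -(cube_avg_cst M (cube_avg N _)) [RHS]exchange_cube_avg.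
apply: eq_cube_avg => sigma _.
rewrite -(cube_avg_flip _ (size_pull sigma)); apply: eq_cube_avg => s sN.
by rewrite signed_sum_pull.
Qed.

End grouping.

Section keyed.
Context (R : realType) (d : measure_display) (Omega : measurableType d)
        (P : probability Omega R) (eps : nat -> {RV P >-> R})
        (X Y : normedModType R[i]) (q r : \bar R) (t : R).
Hypotheses (heps : rademacher eps) (q1 : (1 <= q)%E) (r1 : (1 <= r)%E)
  (t1 : 1 <= t) (hX : has_cotype eps X q) (hY : has_type eps Y t)
  (hr : (r^-1 = t%:E^-1 - q^-1)%E).

(** Type of Y bounds the left-hand side by the ell^t norm of the c i (u i), which
    Holder's inequality splits into the ell^r norm of c and the ell^q norm of u;
    the latter is bounded by cotype of X. *)
Lemma multiplier : exists2 C, 0 < C &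
  forall M (c : 'I_M -> 'L(X, Y)) (u : 'I_M -> X) K, 0 < K ->
    ell_le r (enum 'I_M) (fun i => rnorm (c i)) K ->
    cube_avg M (fun s => rnorm (signed_sum (fun i => c i (u i)) s)) <=
    C * K * cube_avg M (fun s => rnorm (signed_sum u s)).
Proof.
have [CY CY0 type] := has_type_cube_avg heps t1 hY.
have [CX CX0 cotype] := has_cotype_cube_avg heps q1 hX.
exists (CY * CX); first exact: mulr_gt0.
move=> M c u K K0 cK; set A := cube_avg M (fun s => rnorm (signed_sum u s)).
have A0 : 0 <= A by apply: cube_avg_ge0 => s; exact: rnorm_ge0.
apply/ler_addgt0Pr => e e0.
(* The shift by b makes the bound on the family u strictly positive. *)
set b := e / (CY * K).
have b0 : 0 < b by rewrite divr_gt0// mulr_gt0.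
have -> : CY * CX * K * A + e = CY * (K * (CX * A + b)).
  by rewrite /b; field; rewrite !gt_eqF.
have B0 : 0 < CX * A + b by rewrite ltr_wpDl// mulr_ge0// ltW.
apply: type; first by rewrite mulr_ge0// ltW.
apply: (@le_ell_le _ _ _ _ _ (fun i => rnorm (c i) * rnorm (u i))) => //.
  by move=> i; rewrite rnorm_ge0 operator_normP.
apply: (ell_le_hoelder r1 q1 t1 hr) => //; try by move=> i; exact: rnorm_ge0.
have := cotype M u; rewrite -/A.
move: q1; case: (q) => [p| |]//=; rewrite ?lee_fin => p1 h.
  apply: (le_trans h); rewrite ler_powR2// ?lerDl ?(ltW b0)//.
    by rewrite (le_trans _ p1).
  by rewrite mulr_ge0// ltW.
by move=> i si; rewrite (le_trans (h i si))// lerDl ltW.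
Qed.

(** The multiplier bound is applied to the groups of equal operators, for each
    sign pattern of the original sum. *)
Lemma keyed_multiplier : exists2 C, 0 < C &
  forall N (T : eqType) (key : 'I_N -> T) (s : seq T) (c : T -> 'L(X, Y))
    (x : 'I_N -> X) K,
    0 < K -> (forall n, key n \in s) -> ell_le r s (fun k => rnorm (c k)) K ->
    cube_avg N (fun s => rnorm (signed_sum (fun n => c (key n) (x n)) s)) <=
    C * K * cube_avg N (fun s => rnorm (signed_sum x s)).
Proof.
have [C C0 mul] := multiplier; exists C => // N T key s c x K K0 keys cK.
have idxP n : (index (key n) s < size s)%N by rewrite index_mem.
pose g n : 'I_(size s) := Ordinal (idxP n).
pose c' i := c (tnth (in_tuple s) i).
have c'g n : c' (g n) = c (key n).
  by rewrite /c' (tnth_nth (key n))/= nth_index.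
rewrite (cube_avg_group g) [X in _ <= _ * X](cube_avg_group g).
rewrite -cube_avgZ; apply: le_cube_avg => sg _.
rewrite [leLHS](_ : _ = cube_avg (size s) (fun sigma =>
    rnorm (signed_sum (fun i => c' i (group_sum g x sg i)) sigma))).
  apply: mul => //; move: cK; case: (r) => [p| |]//=.
    by rewrite big_tnth big_enum.
  by move=> h i _; apply: h; exact: mem_tnth.
apply: eq_cube_avg => sigma _; congr (rnorm _); apply: eq_bigr => i _.
congr (_ *: _); rewrite linear_sum; apply: eq_bigr => n /eqP <-.
by rewrite linearZ/= c'g.
Qed.

End keyed.

(** * Atoms and convex combinations *)

Section keyed_function.
Context (R : realType) (E : normedModType R[i]).

Lemma fsbig_indic_trivIset (II : set (set R)) (c : set R -> E) I x :
  trivIset II id -> II I -> I x ->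
  (\sum_(I' \in II) (\1_I' x : R[i]) *: c I') = c I.
Proof.
move=> tII III Ix; rewrite -(@fsbig_widen _ _ _ _ [set I]); last 2 first.
- by move=> _ ->.
- move=> I' [III' I'I] /=; rewrite indicE memNset ?scale0r// => I'x.
  by apply: I'I; apply: (tII I' I) => //; exists x.
by rewrite fsbig_set1 indicE mem_set// scale1r.
Qed.

(** What remains of an atom when the geometry of its intervals is forgotten: a
    value for each label, with an ell^r bound over any set of labels. *)
Definition keyed (r K : R) (J : set R) (a : R -> E) :=
  exists (key : R -> set R) (c : set R -> E),
    (forall x, J x -> a x = c (key x)) /\
    (forall s, uniq s -> \sum_(I <- s) rnorm (c I) `^ r <= K).

Lemma keyed0 (r K : R) J : r != 0 -> 0 <= K -> keyed r K J (fun=> 0).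
Proof.
move=> r0 K0; exists (fun=> set0), (fun=> 0); split=> // s _.
by rewrite big1// => i _; rewrite rnorm0 powR0.
Qed.

Lemma normC_Re_ge0 (b : R[i]) : 0 <= complex.Re `|b|.
Proof. by rewrite -ler0c RRe_real// ger0_real. Qed.

Lemma keyedZ (r K : R) J a (b : R[i]) : 0 <= r -> complex.Re `|b| <= K ->
  keyed r 1 J a -> keyed r (K `^ r) J (fun x => b *: a x).
Proof.
move=> r0 bK [key [c [akey c1]]].
exists key, (fun I => b *: c I); split=> [x Jx|s us]; first by rewrite akey.
have K0 : 0 <= K := le_trans (normC_Re_ge0 b) bK.
apply: (@le_trans _ _ (\sum_(I <- s) K `^ r * rnorm (c I) `^ r)).
  apply: ler_sum => I _; rewrite rnormZ -powRM ?rnorm_ge0//.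
  by rewrite ler_powR2 ?mulr_ge0 ?rnorm_ge0 ?normC_Re_ge0// ler_wpM2r ?rnorm_ge0.
by rewrite -mulr_sumr ler_piMr ?powR_ge0// c1.
Qed.

Lemma R_atom_keyed (r : R) J a : 1 <= r -> R_atom r J a -> keyed r 1 J a.
Proof.
move=> r1 [II [c [_ tII cII aE]]].
pose key x := xget set0 [set I | II I /\ I x].
(* A point outside all the intervals gets the label set0; hence c' set0 = 0. *)
pose c' I := if `[< II I /\ I !=set0 >] then c I else 0.
exists key, c'; split=> [x Jx|s us].
  rewrite aE//; have [[I [III Ix]]|noI] := pselect (exists I, II I /\ I x).
    have keyI : key x = I.
      apply: xget_unique => // I' [III' I'x].
      by apply: (tII I' I) => //; exists x.
    rewrite keyI /c' asboolT; last by split=> //; exists x.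
    exact: fsbig_indic_trivIset.
  rewrite fsbig1; last first.
    move=> I III; rewrite indicE memNset ?scale0r// => Ix.
    by apply: noI; exists I.
  rewrite /key xgetPN; last by move=> I IIx; apply: noI; exists I.
  by rewrite /c' asboolF// => -[_ [y]].
pose s' := [seq I <- s | `[< II I /\ I !=set0 >]].
have : ell_le r%:E s' (fun I => rnorm (c I)) 1.
  apply: ell_norm_le cII => //.
  - exact: filter_uniq.
  - by move=> I; rewrite mem_filter => /andP[/asboolP[]].
  - by move=> I _; exact: rnorm_ge0.
rewrite /= powR1 big_filter big_mkcond/=; apply: le_trans.
apply: ler_sum => I _; rewrite /c'; case: ifPn => // _.
by rewrite rnorm0 powR0// gt_eqF// (lt_le_trans _ r1).
Qed.

End keyed_function.

Section replacement.
Context (R : realType) (X Y : normedModType R[i]) (N : nat) (x : 'I_N -> X).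
Implicit Types S T : 'I_N -> 'L(X, Y).

Definition randomized_norm S : R :=
  cube_avg N (fun s => rnorm (signed_sum (fun n => S n (x n)) s)).

Lemma randomized_normD S T : randomized_norm (fun n => S n + T n) <=
  randomized_norm S + randomized_norm T.
Proof.
rewrite /randomized_norm -cube_avgD; apply: le_cube_avg => s _.
apply: le_trans (rnormD _ _); rewrite le_eqVlt; apply/orP; left; apply/eqP.
congr rnorm; rewrite -big_split/=; apply: eq_bigr => n _.
exact: (scalerDr _ (S n (x n)) (T n (x n))).
Qed.

Lemma randomized_normZ (a : R) S :
  randomized_norm (fun n => a%:C *: S n) = `|a| * randomized_norm S.
Proof.
rewrite /randomized_norm -cube_avgZ; apply: eq_cube_avg => s _.
rewrite -rnormZR; congr rnorm; rewrite scaler_sumr; apply: eq_bigr => n _.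
rewrite [(_ *: S n) _](_ : _ = a%:C *: S n (x n))//.
by rewrite !scalerA mulrC.
Qed.

Lemma randomized_norm_le S :
  randomized_norm S <= \sum_(n < N) rnorm (S n) * rnorm (x n).
Proof.
rewrite -[leRHS](cube_avg_cst N); apply: le_cube_avg => s _.
apply: (le_trans (rnorm_sum _ _ _)); apply: ler_sum => n _.
rewrite rnormZR (_ : `|sgn R _| = 1) ?mul1r; first exact: operator_normP.
by rewrite /sgn normrX normrN1 expr1n.
Qed.

(** The weight left over by the mu k is given to S. *)
Lemma randomized_norm_convex S (W : nat -> 'I_N -> 'L(X, Y)) (mu : nat -> R) B m :
  (forall k, 0 <= mu k) -> \sum_(k < m) mu k <= 1 ->
  randomized_norm S <= B ->
  (forall k, randomized_norm (fun n => S n + W k n) <= B) ->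
  randomized_norm (fun n => S n + \sum_(k < m) (mu k)%:C *: W k n) <= B.
Proof.
move=> mu0 mu1 SB WB.
suff : randomized_norm (fun n => S n + \sum_(k < m) (mu k)%:C *: W k n) <=
    (1 - \sum_(k < m) mu k) * randomized_norm S +
    \sum_(k < m) mu k * randomized_norm (fun n => S n + W k n).
  move/le_trans; apply.
  have -> : B = (1 - \sum_(k < m) mu k) * B + \sum_(k < m) mu k * B.
    by rewrite -mulr_suml -mulrDl subrK mul1r.
  apply: lerD; first by rewrite ler_wpM2l// subr_ge0.
  by apply: ler_sum => k _; rewrite ler_wpM2l.
rewrite -[X in X * _]ger0_norm ?subr_ge0// -randomized_normZ.
under [X in _ <= _ + X]eq_bigr => k _.
  rewrite -[X in X * _](ger0_norm (mu0 k)) -randomized_normZ; over.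
have sumS (T0 : 'I_N -> 'L(X, Y)) (T : nat -> 'I_N -> 'L(X, Y)) j :
    randomized_norm (fun n => T0 n + \sum_(k < j) T k n) <=
    randomized_norm T0 + \sum_(k < j) randomized_norm (T k).
  elim: j => [|j IH].
    rewrite big_ord0 addr0 le_eqVlt; apply/orP; left; apply/eqP.
    by congr randomized_norm; apply/funext => n; rewrite big_ord0 addr0.
  rewrite big_ord_recr/= addrA; apply: le_trans (lerD IH (lexx _)).
  apply: le_trans (randomized_normD _ _).
  rewrite le_eqVlt; apply/orP; left; apply/eqP.
  by congr randomized_norm; apply/funext => n; rewrite big_ord_recr/= addrA.
apply: le_trans (sumS (fun n => (1 - \sum_(k < m) mu k)%:C *: S n)
  (fun k n => (mu k)%:C *: (S n + W k n)) m); 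
  rewrite le_eqVlt; apply/orP; left; apply/eqP.
congr randomized_norm; apply/funext => n.
under [X in _ = _ + X]eq_bigr do rewrite scalerDr.
rewrite big_split/= -scaler_suml addrA -scalerDl -raddf_sum/= -rmorphD/=.
by rewrite subrK scale1r.
Qed.

Lemma randomized_norm_series S (W : nat -> 'I_N -> 'L(X, Y)) (mu : nat -> R)
    (Wl : 'I_N -> 'L(X, Y)) B :
  (forall k, 0 <= mu k) -> (forall m, \sum_(k < m) mu k <= 1) ->
  randomized_norm S <= B ->
  (forall k, randomized_norm (fun n => S n + W k n) <= B) ->
  (forall n, (\sum_(k < m) (mu k)%:C *: W k n) @[m --> \oo] --> Wl n) ->
  randomized_norm (fun n => S n + Wl n) <= B.
Proof.
move=> mu0 mu1 SB WB cvgW; apply/ler_addgt0Pr => e e0.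
(* The term 1 only makes D positive. *)
pose D := 1 + \sum_(n < N) rnorm (x n).
have D0 : 0 < D by rewrite ltr_pwDl// sumr_ge0// => n _; exact: rnorm_ge0.
have : \forall m \near \oo, forall n : 'I_N,
    rnorm (Wl n - \sum_(k < m) (mu k)%:C *: W k n) < e / D.
  apply: filter_forall => n; have /cvgrPdist_lt := cvgW n.
  move=> /(_ (e / D)%:C); rewrite ltcR divr_gt0// => /(_ isT).
  by apply: filterS => m; rewrite rnormE ltcR.
move=> [m _ /(_ m (leqnn m)) /= hm].
have -> : (fun n => S n + Wl n) = (fun n =>
    (S n + \sum_(k < m) (mu k)%:C *: W k n) +
    (Wl n - \sum_(k < m) (mu k)%:C *: W k n)).
  by apply/funext => n; rewrite addrACA subrr addr0.
apply: (le_trans (randomized_normD _ _)); apply: lerD.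
  exact: randomized_norm_convex.
apply: (le_trans (randomized_norm_le _)).
apply: (@le_trans _ _ (\sum_(n < N) e / D * rnorm (x n))).
  by apply: ler_sum => n _; rewrite ler_wpM2r ?rnorm_ge0// ltW.
rewrite -mulr_sumr mulrAC ler_pdivrMr// ler_wpM2l ?(ltW e0)//.
by rewrite /D lerDr.
Qed.

End replacement.

(** * Replacing a function by its atoms *)

Section range_of_R_functions.
Context (R : realType) (X Y : normedModType R[i]).

(** Up to the factor L, g lies on J in the closed absolutely convex hull of the
    atoms; the unimodular parts of the coefficients are kept in b, so that the
    weights mu form a convex combination. *)
Definition atomic_series (r L : R) (J : set R) (g : R -> 'L(X, Y)) :=
  exists (a : nat -> R -> 'L(X, Y)) (b : nat -> R[i]) (mu : nat -> R),
  [/\ forall k, R_atom r J (a k), forall k, complex.Re `|b k| <= L,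
      forall k, 0 <= mu k, forall m, \sum_(k < m) mu k <= 1 &
      forall t, J t ->
        (\sum_(k < m) (mu k)%:C *: (b k *: a k t)) @[m --> \oo] --> g t].

Lemma polar (z : R[i]) : exists2 u : R[i],
  z = (complex.Re `|z|)%:C * u & complex.Re `|u| <= 1.
Proof.
have zE : `|z| = (complex.Re `|z|)%:C by rewrite RRe_real// ger0_real.
have [->|z0] := eqVneq z 0; first by exists 0; rewrite ?mulr0 ?normr0.
exists (z / `|z|); first by rewrite -zE mulrCA mulfV ?mulr1// normr_eq0.
by rewrite normrM normfV normr_id mulfV// normr_eq0.
Qed.

Lemma R_norm_lt_atomic_series (r L : R) J g : 0 < L ->
  (R_norm r%:E J g < L%:E)%E -> atomic_series r L J g.
Proof.
move=> L0 /ereal_inf_lt[_ [lam [a [atom _ cvga]] <-] lamL].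
have /choice[u uP] : forall k, exists u : R[i],
    lam k = (complex.Re `|lam k|)%:C * u /\ complex.Re `|u| <= 1.
  by move=> k; have [u ? ?] := polar (lam k); exists u.
exists a, (fun k => L%:C * u k), (fun k => complex.Re `|lam k| / L).
split=> //.
- move=> k; have [_ uk1] := uP k.
  have uE : `|u k| = (complex.Re `|u k|)%:C by rewrite RRe_real// ger0_real.
  have -> : `|L%:C * u k| = (L * complex.Re `|u k|)%:C.
    by rewrite normrM uE ger0_norm ?ler0c ?(ltW L0)// -rmorphM.
  by rewrite /= ler_piMr// ltW.
- by move=> k; rewrite divr_ge0 ?normC_Re_ge0// ltW.
- move=> m; rewrite -mulr_suml ler_pdivrMr// mul1r -lee_fin.
  apply: le_trans (ltW lamL); rewrite /ell1_norm -sumEFin.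
  rewrite -(big_mkord xpredT (fun k => (complex.Re `|lam k|)%:E)).
  by apply: nneseries_lim_ge => k _ _; rewrite lee_fin normC_Re_ge0.
move=> t Jt; set v := (fun m => _).
suff -> : v = (fun m => \sum_(0 <= k < m) lam k *: a k t) by exact: cvga.
apply/funext => m.
rewrite big_mkord; apply: eq_bigr => k _; rewrite scalerA; congr (_ *: _).
have [{2}-> _] := uP k.
by rewrite mulrA -rmorphM/= divfK// gt_eqF.
Qed.

Context (r C : R).
Hypothesis r1 : 1 <= r.
Hypothesis mul : forall N (T : eqType) (key : 'I_N -> T) (s : seq T)
  (c : T -> 'L(X, Y)) (x : 'I_N -> X) K,
  0 < K -> (forall n, key n \in s) -> ell_le r%:E s (fun k => rnorm (c k)) K ->
  cube_avg N (fun s => rnorm (signed_sum (fun n => c (key n) (x n)) s)) <=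
  C * K * cube_avg N (fun s => rnorm (signed_sum x s)).

Variables (N : nat) (x : 'I_N -> X) (J : 'I_N -> set R) (t : 'I_N -> R).
Hypothesis Jt : forall n, J n (t n).
Variables (js : seq (set R)) (L : set R -> R) (K : R).
Hypotheses (Jjs : forall n, J n \in js) (K0 : 0 < K)
  (LK : \sum_(I <- js) L I `^ r <= K `^ r).

Let r0 : 0 < r. Proof. by rewrite (lt_le_trans _ r1). Qed.

(** Labels are paired with the interval they come from, so that the bounds of
    the different intervals add up. *)
Lemma keyed_family (h : set R -> R -> 'L(X, Y)) :
  (forall I, I \in js -> keyed r (L I `^ r) I (h I)) ->
  randomized_norm x (fun n => h (J n) (t n)) <=
  C * K * cube_avg N (fun s => rnorm (signed_sum x s)).
Proof.
move=> hk.
have /choice[p pP] : forall I, exists p : (R -> set R) * (set R -> 'L(X, Y)),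
    I \in js -> (forall t, I t -> h I t = p.2 (p.1 t)) /\
    (forall s, uniq s -> \sum_(A <- s) rnorm (p.2 A) `^ r <= L I `^ r).
  move=> I; have [/hk[key [c kc]]|] := boolP (I \in js); first by exists (key, c).
  by exists (fun=> set0, fun=> 0).
pose key n := (J n, (p (J n)).1 (t n)).
pose c (k : set R * set R) := (p k.1).2 k.2.
pose keys I := undup [seq (p I).1 (t n) | n <- enum 'I_N].
pose s := allpairs_dep (fun I A : set R => (I, A)) js keys.
have := @mul N _ key s c x K K0.
have -> : (fun s => rnorm (signed_sum (fun n => c (key n) (x n)) s)) =
          (fun s => rnorm (signed_sum (fun n => h (J n) (t n) (x n)) s)).
  apply/funext => sg; congr rnorm; apply: eq_bigr => n _; congr (_ *: _).
  by have [/(_ (t n) (Jt n)) -> _] := pP (J n) (Jjs n).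
apply.
  move=> n; apply/allpairsPdep; exists (J n), ((p (J n)).1 (t n)); split=> //.
  by rewrite mem_undup; apply/mapP; exists n => //; rewrite mem_enum.
rewrite /= big_allpairs_dep; apply: le_trans LK.
rewrite big_seq [leRHS]big_seq; apply: ler_sum => I Ijs.
by have [_] := pP I Ijs; apply; exact: undup_uniq.
Qed.

(** On the first interval of todo, h is a limit of convex combinations of 0 and
    of multiples of atoms; by convexity each of these may replace h there, after
    which the induction hypothesis applies. *)
Lemma hybrid_family (todo : seq (set R)) (h : set R -> R -> 'L(X, Y)) :
  (forall I, I \in js -> I \in todo /\ atomic_series r (L I) I (h I) \/
                         keyed r (L I `^ r) I (h I)) ->
  randomized_norm x (fun n => h (J n) (t n)) <=
  C * K * cube_avg N (fun s => rnorm (signed_sum x s)).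
Proof.
elim: todo h => [|I0 todo IH] h hP.
  by apply: keyed_family => I /hP[[]|].
have [I0js|I0js] := boolP (I0 \in js); last first.
  apply: IH => I Ijs; have [[]|] := hP I Ijs; last by right.
  rewrite inE => /orP[/eqP II0|]; last by left.
  by rewrite -II0 Ijs in I0js.
pose h' g I := if I == I0 then g else h I.
have h'P g : keyed r (L I0 `^ r) I0 g ->
    randomized_norm x (fun n => h' g (J n) (t n)) <=
    C * K * cube_avg N (fun s => rnorm (signed_sum x s)).
  move=> gk; apply: IH => I Ijs; rewrite /h'; case: eqVneq => [->|II0]; first by right.
  have [[]|] := hP I Ijs; last by right.
  by rewrite inE (negPf II0) => /= ? ?; left.
have [[_]|/h'P] := hP I0 I0js; last first.
  congr (randomized_norm _ _ <= _); apply/funext => n; rewrite /h'.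
  by case: eqVneq => // ->.
move=> [a [b [mu [atom bL mu0 mu1 cvga]]]].
pose S n := h' (fun=> 0) (J n) (t n).
pose on g n : 'L(X, Y) := if J n == I0 then g (t n) else 0.
have SE g : (fun n => h' g (J n) (t n)) = (fun n => S n + on g n).
  by apply/funext => n; rewrite /S /h' /on; case: eqVneq; rewrite ?add0r ?addr0.
have -> : (fun n => h (J n) (t n)) = (fun n => S n + on (h I0) n).
  by rewrite -SE; apply/funext => n; rewrite /h'; case: eqVneq => // ->.
apply: (@randomized_norm_series _ _ _ _ _ S (fun k => on (fun y => b k *: a k y)) mu) => //.
- by apply: h'P; apply: keyed0; rewrite ?gt_eqF ?powR_ge0.
- move=> k; rewrite -SE; apply: h'P.
  by apply: keyedZ (bL k) _; [exact: ltW|exact: R_atom_keyed].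
- move=> n; rewrite /on; case: eqVneq => [Jn|_].
    by apply: cvga; rewrite -Jn; exact: Jt.
  set v := (fun m => _); suff -> : v = (fun=> 0) by exact: cvg_cst.
  by apply/funext => m; rewrite /v big1// => k _; rewrite scaler0.
Qed.

Lemma atomic_family (f : R -> 'L(X, Y)) :
  (forall I, I \in js -> atomic_series r (L I) I f) ->
  randomized_norm x (fun n => f (t n)) <=
  C * K * cube_avg N (fun s => rnorm (signed_sum x s)).
Proof.
by move=> fa; apply: (@hybrid_family js (fun=> f)) => I Ijs; left; split=> //; exact: fa.
Qed.

End range_of_R_functions.

(** * Passage to the R-bound *)

Section norms_ge0.
Context (R : realType) (E : normedModType R[i]).
Implicit Types (J : set R) (f : R -> E).
Local Open Scope ereal_scope.

Lemma sup0_ge0 (A : set (\bar R)) : 0 <= sup0 A.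
Proof. by apply: ereal_sup_ubound; left. Qed.

Lemma sup0_ub (A : set (\bar R)) z : A z -> z <= sup0 A.
Proof. by move=> Az; apply: ereal_sup_ubound; right. Qed.

Lemma ell1_norm_ge0 (lam : nat -> R[i]) : 0 <= ell1_norm lam.
Proof. by apply: nneseries_ge0 => k _ _; rewrite lee_fin normC_Re_ge0. Qed.

Lemma R_norm_ge0 (r : \bar R) J f : 0 <= R_norm r J f.
Proof.
case: r => [r| |]; [|exact: sup0_ge0|exact: leey].
by apply/ereal_infP => _ [lam _ <-]; exact: ell1_norm_ge0.
Qed.

Lemma V_norm_ge0 (s : R) J f : 0 <= V_norm s J f.
Proof. by rewrite adde_ge0 ?sup0_ge0. Qed.

Lemma ell_norm_ge0 (p : \bar R) (I : choiceType) (A : set I) b :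
  0 <= ell_norm p A b.
Proof.
by case: p => [p| |]; [exact: poweR_ge0|exact: sup0_ge0|exact: lexx].
Qed.

Lemma ell_norm_ub (p : \bar R) (I : choiceType) (A : set I) (b : I -> \bar R) i :
  1 <= p -> A i -> 0 <= b i -> b i <= ell_norm p A b.
Proof.
case: p => [p| |]//= => [p1 Ai bi|_ Ai _]; last by apply: sup0_ub; exists i.
rewrite lee_fin in p1; have p0 : (0 < p)%R by rewrite (lt_le_trans _ p1).
rewrite -[leLHS](poweRe1 bi) -(mulfV (lt0r_neq0 p0)) poweRrM.
rewrite lee_poweR2 ?invr_ge0 ?(ltW p0) ?poweR_ge0//.
have := @sum_le_esum _ _ A [:: i] (fun j => b j `^ p) isT.
by rewrite big_seq1; apply => j; rewrite inE => /eqP ->.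
Qed.

End norms_ge0.

Section R_bounded_range.
Context (R : realType) (d : measure_display) (Omega : measurableType d)
        (P : probability Omega R) (eps : nat -> {RV P >-> R})
        (X Y : normedModType R[i]).
Hypothesis heps : rademacher eps.
Implicit Types (JJ : set (set R)) (f : R -> 'L(X, Y)).
Local Open Scope ereal_scope.

Lemma R_bounded_byE JJ f (C : R) :
  (forall (N : nat) (J : 'I_N -> set R) (t : 'I_N -> R) (x : 'I_N -> X),
    (forall n, JJ (J n)) -> (forall n, J n (t n)) ->
    (randomized_norm x (fun n => f (t n)) <=
     C * cube_avg N (fun s => rnorm (signed_sum x s)))%R) ->
  R_bounded_by eps (Ran JJ f) C.
Proof.
move=> fC N T x TJ.
have /choice[J JP] : forall n, exists J, JJ J /\ (f @` J) (T n).
  by move=> n; have [J JJJ fJ] := TJ n; exists J.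
have /choice[t tP] : forall n, exists t, J n t /\ f t = T n.
  by move=> n; have [_ [t Jt ft]] := JP n; exists t.
rewrite !expectation_rademacher_sum// -EFinM lee_fin.
have -> : T = (fun n => f (t n)) by apply/funext => n; case: (tP n).
by apply: (fC N J t) => n; [have [] := JP n|have [] := tP n].
Qed.

(** The R-bound is an infimum, so it suffices to bound it by every constant
    above the claimed one. *)
Lemma R_bound_le (TT : set 'L(X, Y)) (C : R) (a : \bar R) : (0 < C)%R ->
  0 <= a -> a < +oo ->
  (forall A : R, a < A%:E -> R_bounded_by eps TT (C * A)) ->
  R_bounded eps TT /\ R_bound eps TT <= C%:E * a.
Proof.
case: a => [a| |]// C0; rewrite lee_fin => a0 _ h.
have CA0 (e : R) : (0 < e)%R -> (0 < C * (a + e))%R.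
  by move=> e0; rewrite mulr_gt0// ltr_wpDl.
split; first by exists (C * (a + 1))%R; [exact: CA0|apply: h; rewrite lte_fin ltrDl].
apply/lee_addgt0Pr => e e0.
have eC0 : (0 < e / C)%R by rewrite divr_gt0.
apply: ereal_inf_lbound; exists (C * (a + e / C))%R.
  by split; [exact: CA0|apply: h; rewrite lte_fin ltrDl].
by rewrite -EFinM -EFinD mulrDr mulrCA mulfV ?mulr1// gt_eqF.
Qed.

End R_bounded_range.

Section bounded_by.
Context (R : realType) (d : measure_display) (Omega : measurableType d)
        (P : probability Omega R) (eps : nat -> {RV P >-> R})
        (X Y : normedModType R[i]) (q : \bar R) (t : R).
Hypotheses (heps : rademacher eps) (q1 : (1 <= q)%E)
  (t1 : 1 <= t) (hX : has_cotype eps X q) (hY : has_type eps Y t).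

Lemma sup_norm_R_bounded_by : (+oo^-1 = t%:E^-1 - q^-1)%E ->
  exists2 C, 0 < C & forall JJ (f : R -> 'L(X, Y)) (A : R),
    (forall J, JJ J -> (sup_norm J f <= A%:E)%E) -> 0 < A ->
    R_bounded_by eps (Ran JJ f) (C * A).
Proof.
move=> hr; have [C C0 mul] := keyed_multiplier heps q1 (leey 1%E) t1 hX hY hr.
exists C => // JJ f A fA A0; apply: R_bounded_byE => // N J tt x JJJ Jtt.
apply: (mul N _ id (enum 'I_N) (fun n => f (tt n))) => // [n|n _].
  by rewrite mem_enum.
rewrite -lee_fin; apply: le_trans (fA _ (JJJ n)).
by apply: sup0_ub; exists (tt n).
Qed.

(** The slack in the hypothesis on A is shared among the finitely many
    intervals that meet a given finite part of the range. *)
Lemma ell_R_bounded_by (r : R) : 1 <= r -> (r%:E^-1 = t%:E^-1 - q^-1)%E ->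
  exists2 C, 0 < C & forall JJ (f : R -> 'L(X, Y)) (b : set R -> \bar R) (D A : R),
    0 < D -> (forall J, JJ J -> (0 <= b J)%E) ->
    (forall J, JJ J -> (R_norm r%:E J f <= D%:E * b J)%E) ->
    (ell_norm r%:E JJ b < A%:E)%E -> R_bounded_by eps (Ran JJ f) (C * D * A).
Proof.
move=> r1 hr; have r0 : 0 < r by rewrite (lt_le_trans _ r1).
have r1E : (1 <= r%:E)%E by rewrite lee_fin.
have [C C0 mul] := keyed_multiplier heps q1 r1E t1 hX hY hr.
exists C => // JJ f b D A D0 b0 fb bA; apply: R_bounded_byE => // N J tt x JJJ Jtt.
have nE : (ell_norm r%:E JJ b \is a fin_num)%E.
  by rewrite ge0_fin_numE ?ell_norm_ge0// (lt_trans bA) ?ltry.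
set B := fine (ell_norm r%:E JJ b).
have BE : ell_norm r%:E JJ b = B%:E by rewrite fineK.
have B0 : 0 <= B by rewrite fine_ge0 ?ell_norm_ge0.
have BA : B < A by rewrite -lte_fin -BE.
have A0 : 0 < A by exact: le_lt_trans BA.
pose js := undup [seq J n | n <- enum 'I_N].
have jsJJ I : I \in js -> JJ I.
  by rewrite mem_undup => /mapP[n _ ->].
pose a I := fine (b I).
have aE I : I \in js -> b I = (a I)%:E.
  move=> /jsJJ JI; rewrite fineK// ge0_fin_numE ?b0//.
  by rewrite (le_lt_trans (ell_norm_ub r1E JI (b0 _ JI)))// BE ltry.
have a0 I : I \in js -> 0 <= a I by move=> /jsJJ/b0; exact: fine_ge0.
have aB : \sum_(I <- js) a I `^ r <= B `^ r.
  have := @ell_norm_le _ _ _ JJ js a b B r1E B0 (undup_uniq _) jsJJ a0.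
  by apply; [move=> I /aE ->|rewrite BE].
(* The weight of each interval is raised by its share of A ^ r - B ^ r. *)
pose delta := (A `^ r - B `^ r) / (1 + size js)%:R.
have delta0 : 0 < delta.
  by rewrite divr_gt0 ?ltr0n// subr_gt0 gt0_ltr_powR// nnegrE// ltW.
pose L I := D * (a I `^ r + delta) `^ r^-1.
have -> : C * D * A = C * (D * A) by rewrite mulrA.
have LK : \sum_(I <- js) L I `^ r <= (D * A) `^ r.
  rewrite (eq_bigr (fun I => D `^ r * (a I `^ r + delta))); last first.
    move=> I _; rewrite powRM ?(ltW D0) ?powR_ge0// powRVK ?gt_eqF//.
    by rewrite addr_ge0 ?powR_ge0// ltW.
  rewrite -mulr_sumr powRM ?(ltW D0) ?(ltW A0)// ler_wpM2l ?powR_ge0//.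
  rewrite big_split/= big_const_seq count_predT iter_addr_0.
  apply: le_trans (lerD aB (lexx _)) _; rewrite -lerBrDl.
  rewrite -[leLHS]mulr_natr /delta mulrAC ler_pdivrMr ?ltr0n//.
  by rewrite ler_wpM2l ?ler_nat// subr_ge0 ler_powR2// ltW.
apply: (@atomic_family _ _ _ r C r1 mul N x J tt Jtt js L (D * A)) => //.
- by move=> n; rewrite mem_undup; apply/mapP; exists n; rewrite ?mem_enum.
- exact: mulr_gt0.
move=> I Ijs.
have aL : a I < (a I `^ r + delta) `^ r^-1.
  rewrite -[ltLHS](@powRKV _ (a I) r) ?a0 ?gt_eqF//.
  by rewrite gt0_ltr_powR ?invr_gt0// ?nnegrE ?addr_ge0 ?powR_ge0 ?(ltW delta0)// ltrDl.
apply: R_norm_lt_atomic_series.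
  by rewrite mulr_gt0// (le_lt_trans _ aL)// a0.
apply: (le_lt_trans (fb _ (jsJJ _ Ijs))).
by rewrite aE// -EFinM lte_fin ltr_pM2l.
Qed.

End bounded_by.

(** * Functions of bounded variation *)

Lemma le_powR_le (R : realType) (p x y : R) : 0 < p -> 0 <= x -> 0 <= y ->
  x `^ p <= y `^ p -> x <= y.
Proof.
move=> p0 x0 y0; rewrite !leNgt; apply: contra => yx.
by rewrite gt0_ltr_powR// nnegrE.
Qed.

Section jump_decay.
Context (R : realType) (s r : R).

(** The oscillation of a function of s-variation 1 on a level set of order n is
    at most the s-th root half_root ^ n of 2 ^- n. *)
Definition half_root : R := 2 `^ (- s^-1).

(** Its n-th power is the decay 2 ^- (n / s) of the jumps of order n times the
    growth 2 ^ (n / r) of the ell^r norm of their family. *)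
Definition jump_ratio : R := half_root * 2 `^ r^-1.

Lemma half_root_gt0 : 0 < half_root.
Proof. exact: powR_gt0. Qed.

Lemma jump_ratio_gt0 : 0 < jump_ratio.
Proof. by rewrite mulr_gt0 ?half_root_gt0 ?powR_gt0. Qed.

Lemma jump_ratio_lt1 : 0 < s -> s < r -> jump_ratio < 1.
Proof.
move=> s0 sr; have r0 : 0 < r by exact: lt_trans sr.
have sr0 : 0 < s^-1 - r^-1 by rewrite subr_gt0 ltf_pV2// posrE.
rewrite /jump_ratio /half_root -powRD ?pnatr_eq0 ?implybT//.
have -> : - s^-1 + r^-1 = - (s^-1 - r^-1) by ring.
rewrite powRN invf_lt1 ?powR_gt0//.
apply: (@le_lt_trans _ _ (1 `^ (s^-1 - r^-1))); first by rewrite powR1.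
by rewrite gt0_ltr_powR ?nnegrE// ltr1n.
Qed.

End jump_decay.

Section variation.
Context (R : realType) (E : normedModType R[i]) (s r : R).
Hypotheses (s1 : 1 <= s) (sr : s < r).
Variables (J : set R) (f : R -> E) (A : R).
Hypotheses (intJ : is_interval J) (fA : (V_norm s J f < A%:E)%E).

Let s0 : 0 < s. Proof. by rewrite (lt_le_trans _ s1). Qed.
Let r0 : 0 < r. Proof. exact: lt_trans sr. Qed.
Local Notation theta := (half_root s).
Local Notation ratio := (jump_ratio s r).
Let theta0 : 0 < theta := half_root_gt0 s.
Let ratio0 : 0 < ratio := jump_ratio_gt0 s r.
Let ratio1 : ratio < 1 := jump_ratio_lt1 s0 sr.

Let A0 : 0 < A.
Proof. by rewrite -lte_fin (le_lt_trans (V_norm_ge0 s J f)). Qed.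

Let f_le x : J x -> rnorm (f x) <= A.
Proof.
move=> Jx; rewrite -lee_fin (le_trans _ (ltW fA))//.
apply: le_trans (leeDl _ (sup0_ge0 _)).
by apply: sup0_ub; exists x.
Qed.

(** With the last point fixed, appending a point beyond it adds a jump of f to
    the sum; this makes [variation_up_to] superadditive. *)
Definition chain_sum (x z : R) := exists (N : nat) (tau : nat -> R),
  [/\ forall i, (i <= N)%N -> J (tau i),
      forall i, (i < N)%N -> tau i < tau i.+1, tau N = x &
      z = \sum_(i < N) rnorm (f (tau i.+1) - f (tau i)) `^ s].

Let chain_sum_le x z : chain_sum x z -> z <= A `^ s.
Proof.
move=> [N [tau [Jtau tau_lt _ ->]]].
rewrite -[leLHS](@powRVK _ _ s) ?gt_eqF//; last first.
  by apply: sumr_ge0 => i _; exact: powR_ge0.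
rewrite ler_powR2 ?powR_ge0 ?(ltW s0)// -lee_fin (le_trans _ (ltW fA))//.
apply: le_trans (leeDr _ (sup0_ge0 _)).
by apply: sup0_ub; exists N, tau.
Qed.

Let chain_sum0 x : J x -> chain_sum x 0.
Proof.
move=> Jx; exists 0%N, (fun=> x); split=> //.
by rewrite big_ord0.
Qed.

Let chain_sum_rcons x y z : x < y -> J y -> chain_sum x z ->
  chain_sum y (z + rnorm (f y - f x) `^ s).
Proof.
move=> xy Jy [N [tau [Jtau tau_lt tauN ->]]].
pose tau' i := if (i <= N)%N then tau i else y.
exists N.+1, tau'; split.
- by move=> i _; rewrite /tau'; case: ifPn => [/Jtau|].
- move=> i iN; rewrite /tau' -[(i <= N)%N]ltnS iN; case: ifPn => [/tau_lt//|].
  rewrite -leqNgt => Ni; have -> : i = N by apply/eqP; rewrite eqn_leq Ni andbT -ltnS.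
  by rewrite tauN.
- by rewrite /tau' ltnn.
- rewrite big_ord_recr/= /tau' ltnn leqnn tauN; congr (_ + _).
  by apply: eq_bigr => i _; rewrite ltn_ord ltnW.
Qed.

(** The s-variation, to the power s, of f on the part of J up to x. *)
Definition variation_up_to (x : R) : R := sup (chain_sum x).
Local Notation w := variation_up_to.

Let has_sup_chain_sum x : J x -> has_sup (chain_sum x).
Proof.
move=> Jx; split; first by exists 0; exact: chain_sum0.
by exists (A `^ s) => z; exact: chain_sum_le.
Qed.

Let w_ge0 x : J x -> 0 <= w x.
Proof.
move=> Jx; apply: sup_ubound; last exact: chain_sum0.
by case: (has_sup_chain_sum Jx).
Qed.

Let w_le x : J x -> w x <= A `^ s.
Proof.
move=> Jx; apply: ge_sup; first by case: (has_sup_chain_sum Jx).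
by move=> z; exact: chain_sum_le.
Qed.

Let w_incr x y : x < y -> J x -> J y -> w x + rnorm (f y - f x) `^ s <= w y.
Proof.
move=> xy Jx Jy; rewrite -lerBrDr; apply: ge_sup.
  by case: (has_sup_chain_sum Jx).
move=> z xz; rewrite lerBrDr; apply: sup_ubound.
  by case: (has_sup_chain_sum Jy).
exact: chain_sum_rcons.
Qed.

Let w_homo x y : x <= y -> J x -> J y -> w x <= w y.
Proof.
rewrite le_eqVlt => /orP[/eqP->//|xy] Jx Jy.
by apply: le_trans (w_incr xy Jx Jy); rewrite lerDl powR_ge0.
Qed.

(** The range [0, A ^ s] of the variation is cut into 2 ^ n equal parts. *)
Definition level (n : nat) (x : R) : nat := Num.truncn (2 ^+ n * (w x / A `^ s)).

Let As0 : 0 < A `^ s. Proof. exact: powR_gt0. Qed.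

Let arg_ge0 n x : J x -> 0 <= 2 ^+ n * (w x / A `^ s).
Proof. by move=> Jx; rewrite mulr_ge0 ?exprn_ge0// divr_ge0 ?w_ge0// ltW. Qed.

Let level_le n x : J x -> (level n x < 2 ^ n + 1)%N.
Proof.
move=> Jx; rewrite /level addn1 truncn_lt_nat ?arg_ge0//.
rewrite (@le_lt_trans _ _ (2 ^+ n))// ?ler_piMr ?exprn_ge0//.
  by rewrite ler_pdivrMr// mul1r w_le.
by rewrite -natrX ltr_nat.
Qed.

Let level_homo n x y : x <= y -> J x -> J y -> (level n x <= level n y)%N.
Proof.
move=> xy Jx Jy; apply: le_truncn.
by rewrite ler_wpM2l ?exprn_ge0// ler_wpM2r ?invr_ge0 ?(ltW As0)// w_homo.
Qed.

(** Level sets of order n + 1 refine those of order n. *)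
Let level_pred n x y : J x -> J y ->
  level n.+1 x = level n.+1 y -> level n x = level n y.
Proof.
have half (a : R) : 0 <= a -> Num.truncn a = (Num.truncn (2 * a))./2.
  move=> a0; apply/eqP; rewrite truncn_eq//.
  have /andP[] := truncn_itv (mulr_ge0 (ler0n R 2) a0).
  set k := Num.truncn (2 * a); rewrite -{1 2}(odd_double_half k).
  rewrite -addn1 !natrD -muln2 natrM -addn1 natrD.
  have := ler0n R (odd k); have : (odd k)%:R <= 1 :> R by case: odd; rewrite ?ler01.
  by move=> *; apply/andP; split; lra.
have levelS z : J z -> level n z = (level n.+1 z)./2.
  by move=> Jz; rewrite /level exprS -mulrA -half ?arg_ge0.
by move=> Jx Jy xy; rewrite !levelS// xy.
Qed.

Let oscillation n x y : J x -> J y -> level n x = level n y ->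
  rnorm (f y - f x) <= A * theta ^+ n.
Proof.
wlog xy : x y / x <= y.
  move=> h Jx Jy xy; have [le_xy|/ltW yx] := leP x y; first by apply: h.
  by rewrite -rnormN opprB; apply: h.
move: xy; rewrite le_eqVlt => /orP[/eqP -> *|xy Jx Jy lxy].
  by rewrite subrr rnorm0 mulr_ge0 ?exprn_ge0 ?(ltW A0) ?(ltW theta0).
have At0 : 0 <= A * theta ^+ n by rewrite mulr_ge0 ?exprn_ge0 ?(ltW A0) ?(ltW theta0).
apply: (le_powR_le s0) => //; first exact: rnorm_ge0.
have -> : (A * theta ^+ n) `^ s = A `^ s / 2 ^+ n.
  rewrite powRM ?exprn_ge0 ?(ltW A0) ?(ltW theta0)//; congr (_ * _).
  rewrite -powR_mulrn ?(ltW theta0)// /half_root -!powRrM.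
  have -> : - s^-1 * (n%:R * s) = - n%:R by field; rewrite gt_eqF.
  by rewrite powRN powR_mulrn.
have h1 := w_incr xy Jx Jy.
have /andP[h2 _] := truncn_itv (arg_ge0 n Jx).
have /andP[_ h3] := truncn_itv (arg_ge0 n Jy).
rewrite -/(level n y) -lxy -(@natr1 R (level n x)) in h3; rewrite -/(level n x) in h2.
have h4 : 2 ^+ n * (w y / A `^ s) < 2 ^+ n * (w x / A `^ s) + 1.
  by rewrite (lt_le_trans h3)// lerD2r.
rewrite ler_pdivlMr ?exprn_gt0//.
have : 2 ^+ n * (w y - w x) / A `^ s <= 1 by rewrite mulrBr mulrBl -!mulrA; lra.
rewrite ler_pdivrMr// mul1r => h5; apply: le_trans h5.
by rewrite mulrC ler_wpM2l ?exprn_ge0//; lra.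
Qed.

Definition level_set n x : set R := [set y | J y /\ level n y = level n x].
Local Notation I := level_set.

Definition base_point (B : set R) : R := xget 0 B.

Let level_setE n x y : I n x y -> I n y = I n x.
Proof.
by move=> [Jy xy]; apply/seteqP; split => z [Jz /= zy]; split; rewrite // ?xy// zy.
Qed.

Let base_point_level n x : J x -> I n x (base_point (I n x)).
Proof. by move=> Jx; apply: xgetPex; exists x. Qed.

Let is_interval_level_set n x : is_interval (I n x).
Proof.
move=> y z [Jy ly] [Jz lz] u /andP[yu uz].
have Ju : J u by apply: (intJ Jy Jz); rewrite yu.
split=> //; apply/eqP; rewrite eqn_leq -{1}lz -{1}ly !level_homo//.
Qed.

(** The successive approximations of f by functions constant on level sets. *)
Definition step (n : nat) (x : R) : E :=
  if n is m.+1 then f (base_point (I m x)) else 0.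

Definition step_jump n (B : set R) : E :=
  step n.+1 (base_point B) - step n (base_point B).

Let step_jumpE n x : J x -> step n.+1 x - step n x = step_jump n (I n x).
Proof.
move=> Jx; have [Jb lb] := base_point_level n Jx.
rewrite /step_jump; congr (_ - _); first by rewrite /= (level_setE (conj Jb lb)).
case: n Jb lb => //= n Jb lb.
by rewrite (@level_setE n x)//; split => //; exact: level_pred.
Qed.

Let step_approx n x : J x -> rnorm (f x - step n.+1 x) <= A * theta ^+ n.
Proof. by move=> Jx; have [Jb lb] := base_point_level n Jx; apply: oscillation. Qed.

Let step_jump_le n x : J x -> rnorm (step_jump n (I n x)) <= A / theta * theta ^+ n.
Proof.
move=> Jx; rewrite -step_jumpE//; have [Jb lb] := base_point_level n Jx.
case: n Jb lb => [|n] Jb lb /=.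
  rewrite subr0 expr0 mulr1 (le_trans (f_le Jb))// ler_pdivlMr// ler_piMr ?(ltW A0)//.
  rewrite /half_root powRN invf_le1 ?powR_gt0//.
  rewrite -[leLHS](powRr0 2) ler_powR ?ler1n// invr_ge0 ltW//.
rewrite exprS mulrA divfK ?gt_eqF//.
have [Jb' lb'] := base_point_level n Jx.
by apply: oscillation => //; rewrite lb'; apply/esym/level_pred.
Qed.

Let lambda (n : nat) : R := A / theta * 2 `^ r^-1 * ratio ^+ n.

Let lambda0 n : 0 < lambda n.
Proof. by rewrite mulr_gt0 ?exprn_gt0// mulr_gt0 ?powR_gt0// divr_gt0. Qed.

(** As there are at most 2 ^ n + 1 <= 2 * 2 ^ n level sets of order n, the
    jumps divided by lambda n are the values of an atom. *)
Let lambdaE n : (A / theta * theta ^+ n / lambda n) `^ r = (2 * 2 ^+ n)^-1.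
Proof.
have -> : A / theta * theta ^+ n / lambda n = ((2 `^ r^-1) ^+ n.+1)^-1.
  have u0 : 0 < 2 `^ r^-1 :> R by exact: powR_gt0.
  by rewrite /lambda /jump_ratio exprMn exprS; field; rewrite !expf_neq0 ?gt_eqF.
rewrite -powR_mulrn ?powR_ge0// -powR_inv1 ?powR_ge0// -!powRrM.
have -> : r^-1 * (n.+1%:R * (-1 * r)) = - n.+1%:R by field; rewrite gt_eqF.
by rewrite powRN powR_mulrn// exprS.
Qed.

Let card_levels n (B : seq (set R)) : uniq B ->
  (forall b, b \in B -> exists2 x, J x & b = I n x) -> (size B <= 2 ^ n + 1)%N.
Proof.
move=> uB BI; rewrite -(size_map (fun b => level n (base_point b))).
rewrite -(size_iota 0 (2 ^ n + 1)); apply: uniq_leq_size.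
  rewrite map_inj_in_uniq// => b c /BI[x Jx ->] /BI[y Jy ->] h.
  have [Jbx lbx] := base_point_level n Jx; have [Jby lby] := base_point_level n Jy.
  by apply/esym/level_setE; split=> //; rewrite -lby -h lbx.
move=> _ /mapP[b /BI[x Jx ->] ->]; rewrite mem_iota add0n level_le//.
by have [] := base_point_level n Jx.
Qed.

Let step_atom n :
  R_atom r J (fun x => (lambda n)^-1%:C *: (step n.+1 x - step n x)).
Proof.
exists [set I n x | x in J], (fun B => (lambda n)^-1%:C *: step_jump n B).
have tI : trivIset [set I n x | x in J] id.
  move=> _ _ [x Jx <-] [y Jy <-] /= [z [xz yz]].
  by rewrite -(level_setE xz) (level_setE yz).
split=> //.
- by move=> _ [x Jx <-]; split; [exact: is_interval_level_set|move=> y []].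
- rewrite /= -(poweR1r r^-1).
  apply: lee_poweR2; rewrite ?invr_ge0 ?(ltW r0)//.
    by apply: esum_ge0 => i _; rewrite lee_fin powR_ge0.
  apply/ereal_supP => _ [B [finB BI] <-]; rewrite fsbig_finite//=.
  have BI' b : b \in fset_set B -> exists2 x, J x & b = I n x.
    by rewrite in_fset_set// inE => /BI[x Jx <-]; exists x.
  apply: (@le_trans _ _ (\sum_(b <- fset_set B) ((2 * 2 ^+ n)^-1)%:E)%E).
    rewrite big_seq [leRHS]big_seq; apply: lee_sum => b /BI'[x Jx ->].
    rewrite lee_fin -lambdaE ler_powR2 ?rnorm_ge0 ?(ltW r0)//.
    by rewrite rnormZR gtr0_norm ?invr_gt0// mulrC ler_pM2r ?invr_gt0// step_jump_le.
  rewrite sumEFin lee_fin big_const_seq count_predT iter_addr_0.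
  rewrite -[leLHS]mulr_natl ler_pdivrMr ?mulr_gt0 ?exprn_gt0// mul1r.
  rewrite -natrX -natrM ler_nat (leq_trans (card_levels (fset_uniq _) BI'))//.
  by rewrite mul2n -addnn leq_add2l expn_gt0.
- move=> x Jx; rewrite step_jumpE//; apply/esym.
  by apply: fsbig_indic_trivIset => //; exists x.
Qed.

(** V^s embeds into R^r for s < r: the jumps of order n decay like 2 ^- (n / s)
    while their number grows like 2 ^ n. *)
Lemma R_norm_le_variation : (R_norm r%:E J f <=
  (2 `^ r^-1 / theta / (1 - ratio) * A)%:E)%E.
Proof.
have lambdaC k : complex.Re `|(lambda k)%:C| = lambda k.
  by rewrite ger0_norm// ler0c ltW.
have sum_le m : \sum_(0 <= k < m) lambda k <= 2 `^ r^-1 / theta / (1 - ratio) * A.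
  have r1 : 0 < 1 - ratio by rewrite subr_gt0.
  rewrite big_mkord -mulr_sumr.
  have -> : 2 `^ r^-1 / theta / (1 - ratio) * A =
      A / theta * 2 `^ r^-1 * (1 - ratio)^-1 by field; rewrite !gt_eqF.
  rewrite ler_wpM2l ?mulr_ge0 ?powR_ge0 ?invr_ge0 ?(ltW A0) ?(ltW theta0)//.
  rewrite -[leRHS]mul1r ler_pdivlMr// mulrC -opprB mulNr -subrX1 opprB.
  by rewrite gerBl exprn_ge0// ltW.
have sum_leE : (ell1_norm (fun n => (lambda n)%:C) <=
    (2 `^ r^-1 / theta / (1 - ratio) * A)%:E)%E.
  apply: lime_le.
    by apply: is_cvg_nneseries => k _ _; rewrite lee_fin normC_Re_ge0.
  apply: nearW => m /=; rewrite sumEFin lee_fin.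
  by rewrite (eq_bigr lambda) => [|k _]; [exact: sum_le|exact: lambdaC].
apply: (le_trans _ sum_leE); apply: ereal_inf_lbound.
exists (fun n => (lambda n)%:C) => //.
exists (fun k x => (lambda k)^-1%:C *: (step k.+1 x - step k x)).
split; [exact: step_atom|exact: le_lt_trans sum_leE (ltry _)|].
move=> x Jx; set v := (fun m => _).
have -> : v = (fun m => step m x).
  apply/funext => m; rewrite /v.
  under eq_bigr do rewrite -scaleC_M mulfV ?gt_eqF// scale1r.
  by rewrite telescope_sumr// subr0.
rewrite -cvg_shiftS; apply/cvgrPdist_lt => e e0.
have eE : e = (complex.Re e)%:C by rewrite RRe_real// gtr0_real.
have Re0 : 0 < complex.Re e by rewrite -ltcR -eE.
have theta1 : `|theta| < 1.
  rewrite gtr0_norm// (le_lt_trans _ ratio1)// ler_peMr ?(ltW theta0)//.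
  by rewrite -[leLHS](powRr0 2) ler_powR ?ler1n// invr_ge0 ltW.
have /cvgrPdist_lt/(_ _ Re0) := cvg_geometric A theta1.
apply: filterS => n; rewrite sub0r normrN => An.
rewrite rnormE eE ltcR (le_lt_trans (step_approx n Jx))//.
by rewrite (le_lt_trans (ler_norm _)).
Qed.

End variation.

Lemma R_norm_le_V_norm (R : realType) (E : normedModType R[i]) (s r : R) :
  1 <= s -> s < r -> exists2 D, 0 < D & forall J (f : R -> E),
    is_interval J -> (R_norm r%:E J f <= D%:E * V_norm s J f)%E.
Proof.
move=> s1 sr; have s0 : 0 < s by rewrite (lt_le_trans _ s1).
pose D := 2 `^ r^-1 / half_root s / (1 - jump_ratio s r).
have D0 : 0 < D.
  by rewrite !divr_gt0 ?powR_gt0 ?half_root_gt0 ?subr_gt0 ?jump_ratio_lt1.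
exists D => // J f intJ; have := V_norm_ge0 s J f.
case VE : (V_norm s J f) => [v| |]// v0; last by rewrite gt0_muley ?lte_fin// leey.
apply/lee_addgt0Pr => e e0; rewrite -EFinM -EFinD.
have -> : D * v + e = D * (v + e / D) by field; rewrite gt_eqF.
by apply: R_norm_le_variation => //; rewrite VE lte_fin ltrDl divr_gt0.
Qed.

Lemma conjugate_exponent_ge1 (R : realType) (q r : \bar R) (t : R) :
  (2%:E <= q)%E -> 1 <= t <= 2 -> (r^-1 = t%:E^-1 - q^-1)%E -> (1 <= r)%E.
Proof.
move=> q2 /andP[t1 t2]; have t0 : 0 < t by rewrite (lt_le_trans _ t1).
have tV1 : t^-1 <= 1 by rewrite invf_le1.
rewrite [in t%:E^-1%E]inver gt_eqF//.
suff [x [x0 x1 ->]] : exists x, [/\ 0 <= x, x <= 1 & (t^-1%:E - q^-1 = x%:E)%E].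
  case: r => [r| |]//; rewrite ?invey ?inver ?leey//.
  case: eqP => // r0 [rx]; rewrite lee_fin.
  have xgt0 : 0 < x by rewrite lt_neqAle x0 andbT eq_sym -rx invr_eq0; apply/eqP.
  by rewrite -[r]invrK rx invf_ge1.
case: q q2 => [q| |]//; rewrite ?lee_fin => q2.
  have q0 : 0 < q by rewrite (lt_le_trans _ q2).
  exists (t^-1 - q^-1); rewrite inver gt_eqF//; split=> //.
    by rewrite subr_ge0 lef_pV2 ?posrE// (le_trans t2).
  by rewrite (le_trans _ tV1)// gerBl invr_ge0 ltW.
by exists t^-1; rewrite invey sube0; split=> //; rewrite invr_ge0 ltW.
Qed.

Local Open Scope ereal_scope.

Theorem proposition3p2 (R : realType) (d : measure_display)
    (Omega : measurableType d) (P : probability Omega R)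
    (eps : nat -> {RV P >-> R}) (heps : rademacher eps)
    (X Y : completeNormedModType R[i]) (q : \bar R) (t : R) (r : \bar R)
    (hq : 2%:E <= q) (ht : (1 <= t <= 2)%R)
    (hX : has_cotype eps X q) (hY : has_type eps Y t)
    (hr : r^-1 = t%:E^-1 - q^-1) :
  (exists C : R,
     forall (JJ : set (set R)) (f : R -> 'L(X, Y)),
       disjoint_intervals JJ -> in_ellZ r (R_norm r) JJ f ->
       R_bounded eps (Ran JJ f) /\
       R_bound eps (Ran JJ f) <= C%:E * ellZ_norm r (R_norm r) JJ f) /\
  (forall s : R, (1 <= s)%R -> s%:E < r ->
   exists C : R,
     forall (JJ : set (set R)) (f : R -> 'L(X, Y)),
       disjoint_intervals JJ -> in_ellZ r (V_norm s) JJ f ->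
       R_bounded eps (Ran JJ f) /\
       R_bound eps (Ran JJ f) <= C%:E * ellZ_norm r (V_norm s) JJ f).
Proof.
have q1 : 1 <= q by rewrite (le_trans _ hq)// lee_fin ler1n.
have t1 : (1 <= t)%R by case/andP: ht.
have r1 := conjugate_exponent_ge1 hq ht hr.
case: r r1 hr => [r| |]// r1 hr.
  rewrite lee_fin in r1.
  have [C C0 bounded] := ell_R_bounded_by heps q1 t1 hX hY r1 hr.
  split=> [|s s1 sr].
    exists C => JJ f _ [_ fin]; apply: R_bound_le => //; first exact: ell_norm_ge0.
    move=> A fA; rewrite -[C]mulr1; apply: bounded fA => // J _.
      exact: R_norm_ge0.
    by rewrite mul1e.
  rewrite lte_fin in sr.
  have [D D0 RV] := R_norm_le_V_norm 'L(X, Y) s1 sr.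
  exists (C * D)%R => JJ f [intJJ _] [_ fin].
  apply: R_bound_le => //; [exact: mulr_gt0|exact: ell_norm_ge0|].
  move=> A fA; apply: bounded fA => // J JJJ; first exact: V_norm_ge0.
  by apply: RV; exact: intJJ.
have [C C0 bounded] := sup_norm_R_bounded_by heps q1 t1 hX hY hr.
suff sup_case (Z : set R -> (R -> 'L(X, Y)) -> \bar R) :
    (forall J f, sup_norm J f <= Z J f) -> exists C : R,
    forall (JJ : set (set R)) (f : R -> 'L(X, Y)),
      disjoint_intervals JJ -> in_ellZ +oo Z JJ f ->
      R_bounded eps (Ran JJ f) /\
      R_bound eps (Ran JJ f) <= C%:E * ellZ_norm +oo Z JJ f.
  split=> [|s _ _]; apply: sup_case => // J f.
  by rewrite leeDl ?sup0_ge0.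
move=> fZ; exists C => JJ f _ [_ fin].
apply: R_bound_le => //; first exact: ell_norm_ge0.
move=> A fA; apply: bounded; last first.
  by rewrite -lte_fin (le_lt_trans _ fA)// ell_norm_ge0.
move=> J JJJ; apply: le_trans (fZ J f) (le_trans _ (ltW fA)).
by apply: sup0_ub; exists J.
Qed.
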